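(* Let $(X,F,D)$, $(Y,G)$ satisfy assumptions (A) and (B) stated in the context, and let the imbedding of $X$ into $Y$ be cocompact relatively to $D$. For $s>0$ let $$c_s=\inf_{u\in X:\,G(u)=s}F(u),$$ and let $t>0$. Then for every minimizing sequence $u_k$ for $c_t$ there exists a sequence $g_k\in D$ such that $g_ku_k$ converges $D$-weakly to a point of minimum (that is, to some $w\in X$ with $G(w)=t$ and $F(w)=c_t$) if and only if for every $\tau\in(0,t)$ $$c_t<c_\tau+c_{t-\tau}.$$
   Context: $\rightharpoonup$ denotes weak convergence in $X$. For a sequence of linear operators $g_k$ on $X$, $g_k\rightharpoonup0$ means $g_ku\rightharpoonup0$ for every $u\in X$, and $g_k\not\rightharpoonup0$ is the negation of this. Dislocation space: a triple $(X,F,D)$ such that (1) $X$ is a vector space and $F\in C^2(X)$ is an even nonnegative convex function with $F^{-1}(0)=\{0\}$; $X$ is equipped with the norm $\|u\|=\inf\{\lambda>0:F(\lambda^{-1}u)\le1\}$; (2) with this norm $X$ is a separable reflexive Banach space, and $F$ is continuous on $X$ and uniformly continuous on bounded sets; (3) $D$ is a group of linear operators on $X$, closed with respect to strong (elementwise) convergence, with $F\circ g=F$ for all $g\in D$; (4) if $g_k\in D$, $g_k\not\rightharpoonup0$ and $u_k\rightharpoonup0$, then $g_ku_k\rightharpoonup0$ on a subsequence; (5) whenever $M\in\mathbb N$, sequences $(g_k^{(n)})_{k}\subset D$, $n=1,\dots,M$, satisfy $(g_k^{(m)})^{-1}g_k^{(n)}\rightharpoonup0$ for $m\ne n$, and $(u_k)\subset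 X$ is a bounded sequence with $(g_k^{(n)})^{-1}u_k\rightharpoonup w^{(n)}$, $n=1,\dots,M$, then $\liminf_kF(u_k)\ge\sum_{n=1}^MF(w^{(n)})$ and $F\big(\sum_{n=1}^Mg_k^{(n)}w^{(n)}\big)\to\sum_{n=1}^MF(w^{(n)})$. $D$-weak convergence: $u_k\in X$ converges $D$-weakly to $u\in X$ if $g_k(u_k-u)\rightharpoonup0$ for every sequence $g_k\in D$. Assumption (A): $(X,F,D)$ is a dislocation space; $Y$ is a Banach space and $G\in C^2(Y)$ is an even nonnegative convex function with $G^{-1}(0)=\{0\}$, the norm of $Y$ being $\inf\{\lambda>0:G(\lambda^{-1}u)\le1\}$; $G\in C(X)$; $X$ is continuously imbedded into $Y$; $D$ has an extension into $Y$ such that $G\circ g=G$ for all $g\in D$; and $G(u_k)-G(u)-G(u-u_k)\to0$ whenever $u_k\rightharpoonup u$ in $X$. Assumption (B): $D$ contains a sequence $g_k\rightharpoonup0$. Cocompactness: the continuous imbedding of $X$ into $Y$ is cocompact relatively to $D$ if every $D$-weakly convergent sequence $u_k\in X$ converges in $Y$. A minimizing sequence for $c_t$ is a sequence $u_k\in X$ with $F(u_k)\to c_t$ and $G(u_k)\to t$.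
   Formalization: D-weak convergence of g_k u_k to a point of minimum is asserted on a subsequence of u_k (for the whole sequence the ''if'' part fails, e.g. u_k = (-1)^k w in H^1(R), L^4 with integer translations), and X is assumed nonzero. *)

(* Defs.v *)
From HB Require Import structures.
From mathcomp Require Import all_boot all_order all_algebra.
From mathcomp Require Import all_classical all_reals all_analysis.

Set Implicit Arguments.
Unset Strict Implicit.
Unset Printing Implicit Defensive.

Import Order.TTheory GRing.Theory Num.Theory.
Import numFieldNormedType.Exports.

Local Open Scope classical_set_scope.
Local Open Scope ring_scope.

Section NormedSpaces.
Context {R : realType} {V : normedModType R}.

Definition dual : set (V -> R^o) := [set f | linear f /\ continuous f].

Definition dual_norm (f : V -> R^o) : R :=
  sup [set `|f x| | x in [set x : V | `|x| <= 1]].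

(* [Phi] only matters on [dual]; this says that the canonical embedding of V
   into its bidual is onto. *)
Definition reflexive_space : Prop :=
  forall Phi : (V -> R^o) -> R,
    (forall (a : R) (f g : V -> R^o), dual f -> dual g ->
       Phi (a *: f + g) = a * Phi f + Phi g) ->
    (exists C : R, forall f, dual f -> `|Phi f| <= C * dual_norm f) ->
    exists x : V, forall f, dual f -> Phi f = f x.

Definition separable_space : Prop :=
  exists2 A : set V, countable A & dense A.

Definition weak_cvg (u : nat -> V) (l : V) : Prop :=
  forall f, dual f -> f (u k) @[k --> \oo] --> f l.

Definition op_weak_null (g : nat -> V -> V) : Prop :=
  forall x, weak_cvg (fun k => g k x) 0.

(* Frechet C^2: f is differentiable, x |-> 'd f x is Frechet differentiable
   into the dual with derivative [d2 x], a bounded bilinear form, and d2 is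
   continuous; the operator norms are written out as uniform estimates. *)
Definition C2 (f : V -> R^o) : Prop :=
  (forall x, differentiable f x) /\
  exists d2 : V -> V -> V -> R^o,
    [/\ forall x h, linear (d2 x h),
        forall x k, linear (d2 x ^~ k),
        forall x, exists C : R, forall h k, `|d2 x h k| <= C * `|h| * `|k|,
        forall x (e : R), 0 < e -> \forall h \near (0 : V), forall k,
          `|'d f (x + h) k - 'd f x k - d2 x h k| <= e * `|h| * `|k|
      & forall x (e : R), 0 < e -> \forall y \near x, forall h k,
          `|d2 y h k - d2 x h k| <= e * `|h| * `|k|].

Record norm_generating (F : V -> R^o) : Prop := NormGenerating {
  ng_C2 : C2 F;
  ng_even : forall u, F (- u) = F u;
  ng_ge0 : forall u, 0 <= F u;
  ng_convex : convex_function [set: V] F;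
  ng_eq0 : forall u, F u = 0 <-> u = 0;
  ng_norm : forall u : V,
    `|u| = inf [set l : R | 0 < l /\ F (l^-1 *: u) <= 1] }.

Definition unif_continuous_on_bounded (F : V -> R^o) : Prop :=
  forall A : set V, bounded_set A ->
  forall e : R, 0 < e -> exists2 d : R, 0 < d &
    forall x y, A x -> A y -> `|x - y| < d -> `|F x - F y| < e.

Record operator_group (D : set (V -> V)) : Prop := OperatorGroup {
  og_linear : forall g, D g -> linear g;
  og_id : D id;
  og_comp : forall g h, D g -> D h -> D (g \o h);
  og_inv : forall g, D g -> exists2 h, D h & cancel g h /\ cancel h g }.

Definition strongly_closed (D : set (V -> V)) : Prop :=
  forall (g : nat -> V -> V) (h : V -> V), (forall k, D (g k)) ->
    (forall x, g k x @[k --> \oo] --> h x) -> D h.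

Definition Dweak_cvg (D : set (V -> V)) (u : nat -> V) (l : V) : Prop :=
  forall g : nat -> V -> V, (forall k, D (g k)) ->
    weak_cvg (fun k => g k (u k - l)) 0.

End NormedSpaces.

Arguments reflexive_space {R} V.
Arguments separable_space {R} V.

Definition extraction (phi : nat -> nat) : Prop :=
  {homo phi : m n / (m < n)%N}.

(* In [ds_split], [gi n k] is the inverse of [g n k]. *)
Record dislocation_space {R : realType} (X : completeNormedModType R)
    (F : X -> R^o) (D : set (X -> X)) : Prop := DislocationSpace {
  ds_F : norm_generating F;
  ds_separable : separable_space X;
  ds_reflexive : reflexive_space X;
  ds_continuous : continuous F;
  ds_ucont : unif_continuous_on_bounded F;
  ds_group : operator_group D;
  ds_closed : strongly_closed D;
  ds_invariant : forall g, D g -> F \o g = F;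
  ds_dichotomy : forall (g : nat -> X -> X) (u : nat -> X),
    (forall k, D (g k)) -> ~ op_weak_null g -> weak_cvg u 0 ->
    exists2 phi, extraction phi &
      weak_cvg (fun k => g (phi k) (u (phi k))) 0;
  ds_split : forall (M : nat) (g gi : 'I_M -> nat -> X -> X)
      (u : nat -> X) (w : 'I_M -> X),
    (forall n k, D (g n k)) ->
    (forall n k, cancel (g n k) (gi n k) /\ cancel (gi n k) (g n k)) ->
    (forall m n, m != n -> op_weak_null (fun k => gi m k \o g n k)) ->
    bounded_fun u ->
    (forall n, weak_cvg (fun k => gi n k (u k)) (w n)) ->
    ((\sum_(n < M) F (w n))%:E <= limn_einf (fun k => (F (u k))%:E))%E /\
    F (\sum_(n < M) g n k (w n)) @[k --> \oo] --> \sum_(n < M) F (w n) }.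

Section TwoSpaces.
Context {R : realType} {X Y : completeNormedModType R}.
Variables (F : X -> R^o) (D : set (X -> X)) (G : Y -> R^o) (j : X -> Y).

Record continuous_imbedding : Prop := ContinuousImbedding {
  ci_linear : linear j;
  ci_inj : injective j;
  ci_continuous : continuous j }.

Record assumption_A : Prop := AssumptionA {
  A_dislocation : dislocation_space F D;
  A_G : norm_generating G;
  A_GX : continuous (G \o j);
  A_imbedding : continuous_imbedding;
  A_extension : forall g, D g -> exists gY : Y -> Y,
    [/\ linear gY, forall u, gY (j u) = j (g u) & G \o gY = G];
  A_split : forall (u : nat -> X) (l : X), weak_cvg u l ->
    G (j (u k)) - G (j l) - G (j (l - u k)) @[k --> \oo] --> (0 : R^o) }.

Definition assumption_B : Prop :=
  exists2 g : nat -> X -> X, (forall k, D (g k)) & op_weak_null g.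

Definition cocompact : Prop :=
  forall (u : nat -> X) (l : X), Dweak_cvg D u l -> cvgn (j \o u).

(* For s > 0 the constraint set is nonempty unless X = 0: r |-> G (j (r *: u)) is
   a continuous convex function vanishing only at 0 when u != 0. *)
Definition c_ (s : R) : R := inf [set F u | u in [set u : X | G (j u) = s]].

Definition minimizing (t : R) (u : nat -> X) : Prop :=
  F (u k) @[k --> \oo] --> c_ t /\ G (j (u k)) @[k --> \oo] --> t.

Definition point_of_minimum (t : R) (w : X) : Prop :=
  G (j w) = t /\ F w = c_ t.

End TwoSpaces.

(* Main.v *)
Require Import Defs.
From mathcomp Require Import all_boot all_order all_algebra.
From mathcomp Require Import all_classical all_reals all_analysis.
From HB Require Import structures.
From mathcomp Require Import ring lra.
Import Order.TTheory GRing.Theory Num.Theory.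
Import numFieldNormedType.Exports.
Set Implicit Arguments.
Unset Strict Implicit.
Unset Printing Implicit Defensive.
Local Open Scope classical_set_scope.
Local Open Scope ring_scope.

(** Minimizing sequences are compact modulo [D] exactly when splitting the
    constraint [t] into two parts costs strictly more.

    Three facts are used throughout.  A tangent to a convex function lies below
    its graph, so [F] and [G \o j] are weakly lower semicontinuous, and the
    derivatives of [F] at the points of a countable dense set are functionals
    separating the points of [X].  With reflexivity this gives weakly convergent
    subsequences of bounded sequences, and on bounded sequences weak convergence
    can be tested on those countably many functionals ([weak_cvg_family],
    [weak_compact]).  Finally, a sequence with [G] tending to [s] can be rescaled
    to [G = s] without raising the limit of [F], so it competes for [c_s]
    ([c_le_lim]).

    Sufficiency.  A minimizing sequence does not vanish [D]-weakly, since by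
    cocompactness [G] would tend to [0]; so some translated subsequence [v_k] has
    a weak limit [w != 0].  Put [tau = G w], so that [G (v_k - w)] tends to
    [t - tau].  If [tau = t], lower semicontinuity makes [w] a minimizer, and
    [G (v_k - w) -> 0] forces [D]-weak convergence.  Otherwise a finite system of
    mutually orthogonal profiles of [v_k - w] carries all of [t - tau] up to an
    arbitrarily small error ([profiles_exhaust]).  The energy inequality for [w]
    and these profiles bounds the energy of their superposition by [c_t - F w],
    whence [c_(t - tau) <= c_t - F w <= c_t - c_tau], against strict
    subadditivity.

    In [profiles_exhaust] no infinite profile decomposition is built.  If the
    total [G] of finite systems stayed below the limit, the remainders of nearly
    optimal systems would have only small profiles, and a diagonal sequence of
    such remainders would vanish [D]-weakly while [G] stays positive on it.

    Necessity.  If [c_t >= c_tau + c_(t - tau)], take nearly optimal [u_k] and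
    [v_k] for [tau] and [t - tau], and translate [v_k] so far away by an element
    of a weakly null sequence [h_i] in [D] that energies and constraints add up and that no
    [g] of [D] keeps both [g u_k] and [g h_i v_k] away from zero when tested by
    the first [k] functionals ([translate_sum], [translate_separated]).  The sum
    is a minimizing sequence.  A weak limit of its translates is the sum of the
    weak limits of the two parts, one of which is [0], so [G] of it is at most
    [t - tau] or [tau], and it cannot be a minimizer for [t]. *)

(** * Subsequences *)

Lemma extraction_ge (phi : nat -> nat) (n : nat) :
  extraction phi -> (n <= phi n)%N.
Proof.
move=> phiP; elim: n => // n IH; apply: leq_ltn_trans IH _.
exact: phiP.
Qed.

Lemma extraction_comp (phi psi : nat -> nat) :
  extraction phi -> extraction psi -> extraction (phi \o psi).
Proof. by move=> hphi hpsi m n /hpsi/hphi. Qed.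

Lemma cvg_extraction (phi : nat -> nat) :
  extraction phi -> phi k @[k --> \oo] --> \oo.
Proof.
move=> phiP A [N _ NA]; exists N => // n /= Nn; apply: NA => /=.
exact: leq_trans Nn (extraction_ge _ phiP).
Qed.

Lemma cvg_subseq (T : topologicalType) (u : nat -> T) (l : T) phi :
  extraction phi -> u k @[k --> \oo] --> l -> u (phi k) @[k --> \oo] --> l.
Proof. by move=> /cvg_extraction hphi hu; exact: (cvg_comp _ _ hphi hu). Qed.

(** A property holding frequently at each stage [n] holds at all stages along a
    subsequence. *)
Lemma extract_frequently (P : nat -> nat -> Prop) :
  (forall n N, exists2 k, (N <= k)%N & P n k) ->
  exists2 phi, extraction phi & forall n, P n (phi n).
Proof.
move=> H.
have /choice[h hP] : forall p : nat * nat, exists k, (p.2 <= k)%N /\ P p.1 k.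
  by move=> [n N]; have [k Nk Pk] := H n N; exists k.
pose fix phi n := if n is m.+1 then h (m.+1, (phi m).+1) else h (0%N, 0%N).
exists phi => [|[|n] /=]; [|exact: (hP (_, _)).2..].
have phiS n : (phi n < phi n.+1)%N by exact: (hP (_, _)).1.
by apply: homo_ltn => //; exact: ltn_trans.
Qed.

Lemma extract_not_near (P : nat -> Prop) :
  ~ (\forall k \near \oo, P k) ->
  exists2 phi, extraction phi & forall n, ~ P (phi n).
Proof.
move=> H; apply: (@extract_frequently (fun _ k => ~ P k)) => _ N.
apply: contrapT => K; apply: H; exists N => // k /= Nk.
by apply: contrapT => Pk; apply: K; exists k.
Qed.

(** * Functionals on normed spaces and weak convergence *)

Section Linear.
Context {R : realType} {V W : normedModType R}.
Implicit Types f : V -> W.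

Lemma lin0 f : linear f -> f 0 = 0.
Proof.
by move=> fl; have := fl (-1) 0 0; rewrite scaler0 addr0 scaleN1r addNr.
Qed.

Lemma linD f x y : linear f -> f (x + y) = f x + f y.
Proof. by move=> fl; have := fl 1 x y; rewrite !scale1r. Qed.

Lemma linZ f a x : linear f -> f (a *: x) = a *: f x.
Proof. by move=> fl; have := fl a x 0; rewrite !addr0 (lin0 fl) addr0. Qed.

Lemma linN f x : linear f -> f (- x) = - f x.
Proof. by move=> fl; rewrite -scaleN1r (linZ _ _ fl) scaleN1r. Qed.

Lemma linB f x y : linear f -> f (x - y) = f x - f y.
Proof. by move=> fl; rewrite linD // linN. Qed.

Lemma lin_sum f (I : Type) (r : seq I) (P : pred I) (h : I -> V) :
  linear f -> f (\sum_(i <- r | P i) h i) = \sum_(i <- r | P i) f (h i).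
Proof.
move=> fl; apply: (big_morph f) => [x y|]; [exact: linD|exact: lin0].
Qed.

End Linear.

Section Functionals.
Context {R : realType} {V : normedModType R}.
Implicit Types (f : V -> R^o) (u : nat -> V).

Lemma dual_lipschitz f : dual f ->
  exists2 C : R, 0 <= C & forall x, `|f x| <= C * `|x|.
Proof.
move=> [fl fc].
pose fL : {linear V -> R^o} := HB.pack f (GRing.isLinear.Build _ _ _ _ f fl).
have /linear_boundedP [y [yreal fr]] : bounded_near fL (nbhs (0 : V)).
  by apply/linear_bounded_continuous.
exists (`|y| + 1) => [|x]; first by rewrite addr_ge0.
by apply: fr; rewrite ltr_pwDr // real_ler_norm.
Qed.

Lemma dual_norm_le f x : dual f -> `|f x| <= dual_norm f * `|x|.
Proof.
move=> fD; have [C C0 fC] := dual_lipschitz fD.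
have [->|x0] := eqVneq x 0; first by rewrite (lin0 fD.1) !normr0 mulr0.
have nx : 0 < `|x| by rewrite normr_gt0.
rewrite -ler_pdivrMr //.
apply: ub_le_sup.
  exists C => _ [z /= z1 <-]; apply: (le_trans (fC z)).
  by rewrite ler_piMr.
exists (`|x|^-1 *: x) => /=.
  by rewrite normrZ normfV normr_id mulVf // gt_eqF.
by rewrite (linZ _ _ fD.1) normrZ normfV normr_id mulrC.
Qed.

Lemma weak_cvg_cst (l : V) : weak_cvg (fun=> l) l.
Proof. by move=> f _; exact: cvg_cst. Qed.

Lemma weak_cvgD u v l m : weak_cvg u l -> weak_cvg v m ->
  weak_cvg (fun k => u k + v k) (l + m).
Proof.
move=> hu hv f fD; rewrite (linD _ _ fD.1).
under eq_cvg do rewrite (linD _ _ fD.1).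
by apply: cvgD; [exact: hu|exact: hv].
Qed.

Lemma weak_cvgN u l : weak_cvg u l -> weak_cvg (fun k => - u k) (- l).
Proof.
move=> hu f fD; rewrite (linN _ fD.1).
under eq_cvg do rewrite (linN _ fD.1).
by apply: cvgN; exact: hu.
Qed.

Lemma weak_cvgB u v l m : weak_cvg u l -> weak_cvg v m ->
  weak_cvg (fun k => u k - v k) (l - m).
Proof. by move=> hu hv; apply: weak_cvgD => //; exact: weak_cvgN. Qed.

Lemma weak_cvg_sum (M : nat) (u : 'I_M -> nat -> V) (l : 'I_M -> V) :
  (forall n, weak_cvg (u n) (l n)) ->
  weak_cvg (fun k => \sum_(n < M) u n k) (\sum_(n < M) l n).
Proof.
move=> ul; elim: M u l ul => [|M IH] u l ul.
  rewrite big_ord0; under eq_fun do rewrite big_ord0; exact: weak_cvg_cst.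
rewrite big_ord_recl; under eq_fun do rewrite big_ord_recl.
by apply: weak_cvgD => //; exact: IH.
Qed.

Lemma weak_cvg_subseq u l phi :
  extraction phi -> weak_cvg u l -> weak_cvg (fun k => u (phi k)) l.
Proof. by move=> hphi ul f fD; exact: (cvg_subseq hphi (ul f fD)). Qed.

Lemma eq_weak_cvg u v l : u =1 v -> weak_cvg u l -> weak_cvg v l.
Proof. by move=> /funext ->. Qed.

End Functionals.

(** * Functions generating the norm *)

Section NormGenerating.
Context {R : realType} {V : normedModType R} (F : V -> R^o).
Hypothesis hF : norm_generating F.

Lemma ng0 : F 0 = 0.
Proof. exact/(ng_eq0 hF). Qed.

Lemma ng_gt0 x : x != 0 -> 0 < F x.
Proof.
move=> x0; rewrite lt_neqAle (ng_ge0 hF) andbT eq_sym.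
by apply: contra_neq x0 => /(ng_eq0 hF).
Qed.

Lemma ng_differentiable x : differentiable F x.
Proof. exact: (ng_C2 hF).1. Qed.

Lemma ng_continuous : continuous F.
Proof. by move=> x; exact/differentiable_continuous/ng_differentiable. Qed.

Lemma ng_conv (a : R) x y : 0 <= a <= 1 ->
  F (a *: x + (1 - a) *: y) <= a * F x + (1 - a) * F y.
Proof.
move=> /andP[a0 a1].
have := ng_convex hF (Itv01 a0 a1) (x := x) (y := y).
by rewrite !inE convRE => /(_ I I).
Qed.

Lemma ng_scale_le (a : R) x : 0 <= a <= 1 -> F (a *: x) <= a * F x.
Proof.
by move=> /(@ng_conv _ x 0); rewrite scaler0 addr0 ng0 mulr0 addr0.
Qed.

Lemma ng_scale_ge (a : R) x : 1 <= a -> a * F x <= F (a *: x).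
Proof.
move=> a1; have a0 : 0 < a by exact: lt_le_trans a1.
have /(@ng_scale_le _ (a *: x)) : 0 <= a^-1 <= 1.
  by rewrite invr_ge0 ltW //= invf_le1.
by rewrite scalerA mulVf ?gt_eqF // scale1r -ler_pdivlMl // invrK.
Qed.

(** [F] increases along rays from the origin. *)
Lemma ng_ray (a b : R) x : 0 <= a <= b -> F (a *: x) <= F (b *: x).
Proof.
move=> /andP[a0 ab]; have [b0|b0] := eqVneq b 0.
  by have -> : a = b by lra.
have bp : 0 < b by rewrite lt_neqAle eq_sym b0 (le_trans a0).
have ab1 : 0 <= a / b <= 1.
  by rewrite ler_pdivlMr // mul0r a0 ler_pdivrMr // mul1r.
have -> : a *: x = (a / b) *: (b *: x) by rewrite scalerA divfK.
apply: (le_trans (ng_scale_le _ ab1)).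
by rewrite ler_piMl ?(ng_ge0 hF) //; case/andP: ab1.
Qed.

Lemma ng_norm_le (l : R) x : 0 < l -> F (l^-1 *: x) <= 1 -> `|x| <= l.
Proof.
move=> l0 Fl; rewrite (ng_norm hF); apply: ge_inf => //.
by exists 0 => r [/ltW].
Qed.

(** Sublevel sets of [F] are bounded. *)
Lemma ng_norm_le_max x : `|x| <= Num.max 1 (F x).
Proof.
have m1 : 1 <= Num.max 1 (F x) by rewrite le_max lexx.
have m0 : 0 < Num.max 1 (F x) by exact: lt_le_trans m1.
apply: ng_norm_le => //.
apply: (le_trans (ng_scale_le _ _)).
  by rewrite invr_ge0 ltW //= invf_le1.
by rewrite ler_pdivrMl // mulr1 le_max lexx orbT.
Qed.

Lemma ng_le1 x : `|x| < 1 -> F x <= 1.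
Proof.
move=> x1; move: (x1); rewrite [X in X < _](ng_norm hF) => /inf_lt [].
  exists (Num.max 1 (F x)).
  have m1 : 1 <= Num.max 1 (F x) by rewrite le_max lexx.
  have m0 : 0 < Num.max 1 (F x) by exact: lt_le_trans m1.
  split => //.
  apply: (le_trans (ng_scale_le _ _)).
    by rewrite invr_ge0 ltW //= invf_le1.
  by rewrite ler_pdivrMl // mulr1 le_max lexx orbT.
move=> l [l0 Fl] l1.
have -> : x = l *: (l^-1 *: x) by rewrite scalerA divff ?scale1r // gt_eqF.
apply: (le_trans (ng_scale_le _ _)); first by rewrite !ltW.
by rewrite (le_trans _ (ltW l1)) // ler_piMr // ltW.
Qed.

(** The graph of [F] lies above its tangents. *)
Lemma ng_gradient x y : F x + 'd F x (y - x) <= F y.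
Proof.
have dF := ng_differentiable x.
have /cvg_ex[l hl] : derivable F x (y - x) by exact: diff_derivable.
have ld : l = 'd F x (y - x).
  rewrite -(deriveE _ dF); apply/esym/cvg_lim => //.
rewrite -ld -lerBrDl.
have hr : h^-1 *: (F (h *: (y - x) + x) - F x) @[h --> (0:R)^'+] --> l.
  exact: cvg_dnbhs_at_right.
apply: (closed_cvg (fun z : R => z <= F y - F x)) hr => //.
near=> h.
have h0 : 0 < h by [].
have h1 : h <= 1 by near: h; exact: nbhs_right_le.
rewrite /= [_ *: _]mulrC ler_pdivrMr //.
have -> : h *: (y - x) + x = h *: y + (1 - h) *: x.
  by rewrite scalerBr scalerBl scale1r -!addrA [- _ + _]addrC.
have /(@ng_conv _ y x) : 0 <= h <= 1 by rewrite (ltW h0).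
move/lerB/(_ (lexx (F x))) => /le_trans; apply.
lra.
Unshelve. all: by end_near. Qed.

Lemma ng_gradient_dual x : dual ('d F x : V -> R^o).
Proof.
split; first by move=> a u v; rewrite linearP.
exact: diff_continuous (ng_differentiable x).
Qed.

Lemma ng_bounded_seq (u : nat -> V) (B : R) :
  (forall k, F (u k) <= B) -> forall k, `|u k| <= Num.max 1 B.
Proof.
move=> hB k; apply: (le_trans (ng_norm_le_max _)).
by rewrite ge_max !le_max lexx /= (hB k) orbT.
Qed.

End NormGenerating.

(** Weak lower semicontinuity along a bounded operator: the tangent of [F] at the
    limit lies below [F] and is weakly continuous. *)
Lemma ng_weak_lsc {R : realType} {X Y : normedModType R} (F : Y -> R^o)
    (T : X -> Y) (u : nat -> X) (l : X) (a : nat -> R) (b : R) :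
  norm_generating F -> linear T -> continuous T -> weak_cvg u l ->
  (\forall k \near \oo, F (T (u k)) <= a k) -> a k @[k --> \oo] --> b ->
  F (T l) <= b.
Proof.
move=> hF Tl Tc ul Fa ab.
set d : Y -> R^o := 'd F (T l).
have [dl dc] : dual d := ng_gradient_dual hF (T l).
have dT : dual (d \o T).
  split; first by move=> c x y /=; rewrite Tl dl.
  by move=> x; apply: continuous_comp; [exact: Tc|exact: dc].
have h : F (T l) + (d (T (u k)) - d (T l)) @[k --> \oo] --> (F (T l) : R).
  rewrite -[X in _ --> X]addr0; apply: cvgD; first exact: cvg_cst.
  rewrite -(subrr (d (T l))); apply: cvgB; last exact: cvg_cst.
  exact: ul dT.
apply: (ler_cvg_to h ab).
near=> k; apply: (@le_trans _ _ (F (T (u k)))); last by near: k.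
by rewrite -(linB _ _ dl) -/d; exact: ng_gradient.
Unshelve. all: by end_near. Qed.

(** * Sequential weak compactness *)

Lemma near_forall_ltn (U : set_system nat) (P : nat -> nat -> Prop) (n : nat) :
  Filter U -> (forall i, \forall k \near U, P i k) ->
  \forall k \near U, forall i, (i < n)%N -> P i k.
Proof.
move=> UF UP; elim: n => [|n IH]; first by near=> k.
near=> k => i; rewrite ltnS leq_eqVlt => /predU1P[->|].
  by near: k; exact: UP.
by move: i; near: k.
Unshelve. all: by end_near. Qed.

Lemma cvgr_inv_bound {R : realType} (a : nat -> R) (l : R) :
  (\forall n \near \oo, `|l - a n| <= n.+1%:R^-1) ->
  a n @[n --> \oo] --> (l : R).
Proof.
move=> ha; apply/cvgrPdist_lt => e e0; near=> n.
apply: (@le_lt_trans _ _ n.+1%:R^-1); first by near: n.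
near: n; exact: (near_infty_natSinv_lt (PosNum e0)).
Unshelve. all: by end_near. Qed.

Lemma bounded_funW {R : realType} {T : Type} {V : normedModType R}
    (u : T -> V) (B : R) :
  (forall k, `|u k| <= B) -> bounded_fun u.
Proof.
move=> uB; exists B; split; first by rewrite num_real.
by move=> M BM k _; apply: le_trans (uB k) (ltW BM).
Qed.

Section WeakCompactness.
Context {R : realType} {X : normedModType R} (F : X -> R^o).
Hypothesis hF : norm_generating F.

(** Derivatives of [F] at the points of a countable dense set separate points:
    if they all vanish at [x], then [F (a - x) >= F a] for all these [a], hence
    [F 0 >= F x] by continuity. *)
Lemma separating_family : separable_space X ->
  exists f : nat -> X -> R^o,
    (forall i, dual (f i)) /\ forall x, (forall i, f i x = 0) -> x = 0.
Proof.
move=> [A cA dA].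
have /countable_injP[h hinj] := cA.
have /choice[a ha] : forall i : nat, exists p : X,
    (exists b, A b /\ h b = i) -> A p /\ h p = i.
  move=> i; have [[b hb]|nb] := pselect (exists b, A b /\ h b = i).
    by exists b.
  by exists 0 => /nb.
exists (fun i => 'd F (a i) : X -> R^o).
split; first by move=> i; exact: ng_gradient_dual.
move=> x fx; apply: contrapT => /eqP x0.
have Fx := ng_gt0 hF x0.
have Fx2 : F x / 2 < F x by rewrite ltr_pdivrMr //; lra.
pose O : set X := [set b | F x / 2 < F b /\ F (b - x) < F x / 2].
have xO : nbhs x O.
  have h1 : \forall b \near x, F x / 2 < F b.
    move: Fx2; apply: (@cvgr_gt R _ (nbhs x) _ F (F x)).
    exact: (ng_continuous hF).
  have h2 : \forall b \near x, F (b - x) < F x / 2.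
    have c0 : F (b - x) @[b --> x] --> (F (x - x) : R).
      apply: (@continuous_comp _ _ _ (fun b => b - x) F).
        by apply: cvgB; [exact: cvg_id|exact: cvg_cst].
      exact: ng_continuous.
    by apply: (@cvgr_lt R _ (nbhs x) _ _ _ c0); rewrite subrr (ng0 hF) divr_gt0.
  exact: filterI h1 h2.
have [|b [/interior_subset Ob Ab]] := dA O^° _ (open_interior O).
  by exists x.
have [Ah hb] := ha (h b) (ex_intro _ b (conj Ab erefl)).
have eb : a (h b) = b by apply: hinj; rewrite ?inE.
have := ng_gradient hF b (b - x).
rewrite addrAC subrr add0r (linN _ (ng_gradient_dual hF b).1).
have -> : 'd F b x = 0 by have := fx (h b); rewrite eb.
move: Ob => [] /=; lra.
Qed.

(** Reflexivity represents the functional [f |-> lim_U f (u k)]. *)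
Lemma ultra_weak_limit (U : set_system nat) (u : nat -> X) (B : R) :
  UltraFilter U -> reflexive_space X -> (forall k, `|u k| <= B) ->
  exists x, forall f, dual f -> f (u k) @[k --> U] --> f x.
Proof.
move=> UU rX uB.
have UP : ProperFilter U by exact: ultra_proper.
have fB f k : dual f -> `|f (u k)| <= B * dual_norm f.
  move=> fD; apply: (le_trans (dual_norm_le _ fD)).
  rewrite mulrC ler_wpM2r //.
  apply: ub_le_sup; last by exists 0; rewrite /= ?normr0 ?(lin0 fD.1) ?normr0.
  have [C C0 fC] := dual_lipschitz fD.
  exists C => _ [z /= z1 <-]; apply: (le_trans (fC z)).
  by rewrite ler_piMr.
have /choice[Phi hPhi] : forall f : X -> R^o, exists l : R,
    dual f -> f (u k) @[k --> U] --> (l : R^o).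
  move=> f; have [fD|nD] := pselect (dual f); last by exists 0 => /nD.
  have : compact `[- (B * dual_norm f), B * dual_norm f]%classic.
    exact: segment_compact.
  move=> /(_ (f (u k) @[k --> U]) _) [].
    by apply: (@filterE _ U) => k; rewrite /= in_itv /= -ler_norml; exact: fB.
  move=> l [_ cl]; exists l => _ V lV.
  have [//|UnV] := in_ultra_setVsetC (fun k => V (f (u k))) UU.
  have [z [nVz Vz]] := cl (~` V) V UnV lV.
  by [].
have Phi_lin : forall (a : R) (f g : X -> R^o), dual f -> dual g ->
    Phi (a *: f + g) = a * Phi f + Phi g.
  move=> a f g fD gD.
  have afg : dual (a *: f + g).
    split.
      move=> c x y; rewrite !fctE fD.1 gD.1 !scalerDr !scalerA.
      by rewrite [c * a]mulrC addrACA.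
    move=> x; apply: cvgD; last exact: gD.2.
    by apply: cvgZ; [exact: cvg_cst|exact: fD.2].
  apply: (cvg_unique (@norm_hausdorff _ R^o) (hPhi _ afg)).
  have -> : (fun k => (a *: f + g) (u k)) =
      (fun k => a *: f (u k) + g (u k)) by [].
  apply: cvgD; last exact: hPhi.
  by apply: cvgZ; [exact: cvg_cst|exact: hPhi].
have [|x hx] := rX Phi Phi_lin.
  exists B => f fD.
  have c : `|f (u k)| @[k --> U] --> `|Phi f| by apply: cvg_norm; exact: hPhi.
  by apply: (cvgr_to_le c); apply: filterE => k; exact: fB.
by exists x => f fD; rewrite -hx //; exact: hPhi.
Qed.

Section Family.
Context (f : nat -> X -> R^o).
Hypotheses (fD : forall i, dual (f i))
  (fsep : forall x, (forall i, f i x = 0) -> x = 0).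

(** On bounded sequences of a reflexive space, a countable separating family
    tests weak convergence: all ultrafilter limits agree. *)
Lemma weak_cvg_family (u : nat -> X) (l : X) (B : R) :
  reflexive_space X -> (forall k, `|u k| <= B) ->
  (forall i, f i (u k) @[k --> \oo] --> f i l) -> weak_cvg u l.
Proof.
move=> rX uB ul h hD; apply/cvgrPdist_lt => e e0.
apply: contrapT => /extract_not_near[phi hphi nphi].
have [U [UU sU]] := @ultraFilterLemma nat (nbhs \oo) _.
have [x hx] := ultra_weak_limit UU rX (fun k => uB (phi k)).
have xl : x = l.
  apply/subr0_eq/fsep => i; rewrite (linB _ _ (fD i).1).
  apply/eqP; rewrite subr_eq0; apply/eqP.
  apply: (cvg_unique (@norm_hausdorff _ R^o) (hx _ (fD i))).
  by move=> V /(cvg_subseq hphi (ul i)); exact: sU.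
have /cvgrPdist_lt/(_ _ e0) := hx _ hD.
rewrite xl => Ue.
have /filter_ex[k] := Ue.
exact: nphi.
Qed.

Lemma weak_compact_family (u : nat -> X) (B : R) :
  reflexive_space X -> (forall k, `|u k| <= B) ->
  exists2 phi, extraction phi & exists x, weak_cvg (fun k => u (phi k)) x.
Proof.
move=> rX uB.
have [U [UU sU]] := @ultraFilterLemma nat (nbhs \oo) _.
have [x hx] := ultra_weak_limit UU rX uB.
have [|phi hphi phiP] := @extract_frequently
    (fun n k => forall i, (i < n.+1)%N -> `|f i x - f i (u k)| <= n.+1%:R^-1).
  move=> n N.
  have UN : \forall k \near U, (N <= k)%N by apply: sU; exact: nbhs_infty_ge.
  have UP : \forall k \near U, forall i, (i < n.+1)%N ->
      `|f i x - f i (u k)| <= n.+1%:R^-1.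
    apply: near_forall_ltn => i.
    have /cvgrPdist_le := hx _ (fD i); apply.
    by rewrite invr_gt0 ltr0n.
  have [k [Nk Pk]] := filter_ex (filterI UN UP).
  by exists k.
exists phi => //; exists x.
apply: (@weak_cvg_family _ _ B) => // i.
apply: cvgr_inv_bound; near=> n; apply: phiP; rewrite ltnS; near: n.
exact: nbhs_infty_ge.
Unshelve. all: by end_near. Qed.

End Family.

Lemma weak_compact (u : nat -> X) (B : R) :
  separable_space X -> reflexive_space X -> (forall k, `|u k| <= B) ->
  exists2 phi, extraction phi & exists x, weak_cvg (fun k => u (phi k)) x.
Proof.
move=> /separating_family[f [fD fsep]] rX uB.
exact: (weak_compact_family fD fsep rX uB).
Qed.

Lemma weak_cvg_unique (u : nat -> X) (l m : X) :
  weak_cvg u l -> weak_cvg u m -> l = m.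
Proof.
move=> ul um; apply/subr0_eq; apply: contrapT => /eqP n0.
have := ng_gradient hF (l - m) 0.
rewrite sub0r (ng0 hF).
set d := 'd F (l - m) => hd.
have dD : dual (d : X -> R^o) := ng_gradient_dual hF (l - m).
have d0 : d (l - m) = 0.
  rewrite (linB _ _ dD.1); apply/eqP; rewrite subr_eq0; apply/eqP.
  exact: (cvg_unique (@norm_hausdorff _ R^o) (ul _ dD) (um _ dD)).
move: hd; rewrite (linN _ dD.1) d0 oppr0 addr0 => hd.
by have := ng_gt0 hF n0; rewrite ltNge hd.
Qed.

(** A bounded sequence that is not weakly null has a nonzero weak limit along
    some subsequence. *)
Lemma not_weak_null (u : nat -> X) (B : R) :
  separable_space X -> reflexive_space X -> (forall k, `|u k| <= B) ->
  ~ weak_cvg u 0 ->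
  exists2 phi, extraction phi &
    exists2 x, x != 0 & weak_cvg (fun k => u (phi k)) x.
Proof.
move=> sX rX uB /existsNP[f /not_implyP[fD]].
rewrite (lin0 fD.1) => nu.
have [e e0 ne] : exists2 e : R, 0 < e & ~ \forall k \near \oo, `|f (u k)| < e.
  apply: contrapT => H; apply: nu; apply/cvgr0Pnorm_lt => e e0.
  by apply: contrapT => K; apply: H; exists e.
have [phi hphi nphi] := extract_not_near ne.
have [psi hpsi [x hx]] := weak_compact sX rX (fun k => uB (phi k)).
exists (phi \o psi); first exact: extraction_comp.
exists x => //; apply/eqP => x0.
have /cvgr0Pnorm_lt/(_ e e0) : f (u (phi (psi k))) @[k --> \oo] --> (0 : R).
  by rewrite -(lin0 fD.1) -[in X in _ --> X]x0; exact: hx.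
by move=> /filter_ex[k]; exact: nphi.
Qed.

End WeakCompactness.

(** * Profiles of a sequence modulo the group *)

(** The family [x, f 0, ..., f (M - 1)] indexed by ['I_M.+1]. *)
Definition ord_cons {T : Type} {M : nat} (x : T) (f : 'I_M -> T)
    (i : 'I_M.+1) : T :=
  oapp f x (unlift ord0 i).

Lemma ord_cons0 {T : Type} {M : nat} (x : T) (f : 'I_M -> T) :
  ord_cons x f ord0 = x.
Proof. by rewrite /ord_cons unlift_none. Qed.

Lemma ord_consS {T : Type} {M : nat} (x : T) (f : 'I_M -> T) (i : 'I_M) :
  ord_cons x f (lift ord0 i) = f i.
Proof. by rewrite /ord_cons liftK. Qed.

Section Dislocation.
Context {R : realType} {X : completeNormedModType R}.
Context (F : X -> R^o) (D : set (X -> X)).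
Hypothesis hD : dislocation_space F D.

Let hF : norm_generating F := ds_F hD.

Lemma D_lin g : D g -> linear g.
Proof. exact: og_linear (ds_group hD) g. Qed.

Lemma D_F g x : D g -> F (g x) = F x.
Proof. by move=> /(ds_invariant hD) /(congr1 (@^~ x)). Qed.

Lemma D_norm g x : D g -> `|g x| = `|x|.
Proof.
move=> gD; rewrite !(ng_norm hF); congr inf.
by apply/funext => l /=; rewrite -(linZ _ _ (D_lin gD)) D_F.
Qed.

Lemma D_inverse (g gi : X -> X) : D g -> cancel g gi -> D gi.
Proof.
move=> gD gK; have [h hD' [_ hK]] := og_inv (ds_group hD) gD.
suff -> : gi = h by [].
by apply/funext => x; rewrite -[in LHS](hK x) gK.
Qed.

Lemma D_seq_inverse (g : nat -> X -> X) : (forall k, D (g k)) ->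
  exists gi : nat -> X -> X,
    forall k, cancel (g k) (gi k) /\ cancel (gi k) (g k).
Proof.
move=> gD; have /choice[gi hgi] : forall k, exists h : X -> X,
    cancel (g k) h /\ cancel h (g k).
  by move=> k; have [h _ hP] := og_inv (ds_group hD) (gD k); exists h.
by exists gi.
Qed.

Lemma op_weak_null_subseq (g : nat -> X -> X) phi :
  extraction phi -> op_weak_null g -> op_weak_null (fun k => g (phi k)).
Proof. by move=> hphi gn x; exact: weak_cvg_subseq (gn x). Qed.

(** An operator sequence that turns a weakly null sequence into one with a nonzero
    weak limit is itself weakly null: this is the dichotomy axiom, read
    contrapositively. *)
Lemma op_weak_null_of_limit (b : nat -> X -> X) (a : nat -> X) (w : X) :
  (forall k, D (b k)) -> weak_cvg a 0 -> weak_cvg (fun k => b k (a k)) w ->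
  w != 0 -> op_weak_null b.
Proof.
move=> bD a0 bw w0; apply: contrapT => nb.
have [phi hphi ba0] := ds_dichotomy hD bD nb a0.
move/eqP: w0; apply; exact: (weak_cvg_unique hF (weak_cvg_subseq hphi bw) ba0).
Qed.

Hypothesis X_nontrivial : exists u : X, u != 0.

Lemma op_weak_null_inverse (g gi : nat -> X -> X) :
  (forall k, D (g k)) -> (forall k, cancel (g k) (gi k)) ->
  op_weak_null g -> op_weak_null gi.
Proof.
move=> gD gK gn; have [x x0] := X_nontrivial.
(* [gi k] brings the weakly null sequence [g k x] back to [x]. *)
apply: (@op_weak_null_of_limit _ (fun k => g k x) x) => //.
  by move=> k; exact: D_inverse (gD k) (gK k).
by apply: (eq_weak_cvg _ (@weak_cvg_cst _ _ x)) => k; rewrite gK.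
Qed.

(** The sequence [u] has the profiles [w n] along the mutually orthogonal
    sequences [g n] of the group, [gi n k] being the inverse of [g n k]. *)
Record profiles (u : nat -> X) (M : nat) (g gi : 'I_M -> nat -> X -> X)
    (w : 'I_M -> X) : Prop := Profiles {
  pr_D : forall n k, D (g n k);
  pr_K : forall n k, cancel (g n k) (gi n k) /\ cancel (gi n k) (g n k);
  pr_orth : forall m n, m != n -> op_weak_null (fun k => gi m k \o g n k);
  pr_lim : forall n, weak_cvg (fun k => gi n k (u k)) (w n) }.

Arguments pr_lim {u M g gi w} _ n.
Arguments pr_orth {u M g gi w} _ m n _ x.

(** The sum of the translated profiles [g n k (w n)]. *)
Definition superposition (M : nat) (g : 'I_M -> nat -> X -> X) (w : 'I_M -> X)
  (k : nat) : X := \sum_(n < M) g n k (w n).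

Section Profiles.
Context (u : nat -> X) (M : nat) (g gi : 'I_M -> nat -> X -> X) (w : 'I_M -> X).
Hypothesis hP : profiles u g gi w.

Lemma pr_Di n k : D (gi n k).
Proof. exact: D_inverse (pr_D hP n k) (pr_K hP n k).1. Qed.

Lemma profiles_subseq phi : extraction phi ->
  profiles (fun k => u (phi k)) (fun n k => g n (phi k))
    (fun n k => gi n (phi k)) w.
Proof.
move=> hphi; split => [n k|n k|m n mn|n].
- exact: pr_D hP _ _.
- exact: pr_K hP _ _.
- exact: (op_weak_null_subseq hphi (pr_orth hP m n mn)).
- exact: (weak_cvg_subseq hphi (pr_lim hP n)).
Qed.

Lemma superposition_lim n :
  weak_cvg (fun k => gi n k (superposition g w k)) (w n).
Proof.
have := @weak_cvg_sum R X M (fun m k => gi n k (g m k (w m)))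
  (fun m => if m == n then w m else 0).
rewrite -big_mkcond big_pred1_eq => H.
apply: eq_weak_cvg (H _) => [k|m].
  by rewrite (lin_sum _ _ _ (D_lin (pr_Di n k))).
have [->|mn] := eqVneq m n; last by apply: (pr_orth hP); rewrite eq_sym.
apply: (eq_weak_cvg _ (@weak_cvg_cst _ _ (w n))) => k.
by rewrite (pr_K hP n k).1.
Qed.

Arguments superposition_lim n : clear implicits.

Lemma profiles_superposition : profiles (superposition g w) g gi w.
Proof.
split; [exact: pr_D hP|exact: pr_K hP|exact: pr_orth hP|].
exact: superposition_lim.
Qed.

Lemma remainder_lim n :
  weak_cvg (fun k => gi n k (u k - superposition g w k)) 0.
Proof.
rewrite -(subrr (w n)).
apply: eq_weak_cvg (weak_cvgB (pr_lim hP n) (superposition_lim n)) => k.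
by rewrite (linB _ _ (D_lin (pr_Di n k))).
Qed.

Arguments remainder_lim n : clear implicits.

(** Orthogonality of a new translation sequence [h] to the old ones has to be
    checked on one side only, inverses of weakly null sequences being weakly
    null. *)
Lemma profiles_cons (h hi : nat -> X -> X) (x : X) :
  (forall k, D (h k)) ->
  (forall k, cancel (h k) (hi k) /\ cancel (hi k) (h k)) ->
  (forall n, op_weak_null (fun k => hi k \o g n k)) ->
  weak_cvg (fun k => hi k (u k)) x ->
  profiles u (ord_cons h g) (ord_cons hi gi) (ord_cons x w).
Proof.
move=> hD' hK hn hu; split => [n k|n k|m n|n].
- case: (unliftP ord0 n) => [n' ->|->]; rewrite ?ord_consS ?ord_cons0 //.
  exact: pr_D hP _ _.
- case: (unliftP ord0 n) => [n' ->|->]; rewrite ?ord_consS ?ord_cons0 //.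
  exact: pr_K hP _ _.
- case: (unliftP ord0 m) => [m' ->|->]; case: (unliftP ord0 n) => [n' ->|->];
    rewrite ?ord_consS ?ord_cons0 ?eqxx // => mn.
  + by apply: (pr_orth hP); apply: contra_neq mn => ->.
  + apply: (@op_weak_null_inverse (fun k => hi k \o g m' k)) => //.
      move=> k; apply: (og_comp (ds_group hD)); last exact: pr_D hP _ _.
      exact: D_inverse (hD' k) (hK k).1.
    move=> k y /=; rewrite (hK k).2; exact: (pr_K hP m' k).1.
- case: (unliftP ord0 n) => [n' ->|->]; rewrite ?ord_consS ?ord_cons0 //.
  exact: pr_lim hP _.
Qed.

(** A nonzero weak limit of a translated remainder is a further profile. *)
Lemma profiles_extend (h hi : nat -> X -> X) (x : X) :
  (forall k, D (h k)) ->
  (forall k, cancel (h k) (hi k) /\ cancel (hi k) (h k)) ->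
  weak_cvg (fun k => hi k (u k - superposition g w k)) x -> x != 0 ->
  profiles u (ord_cons h g) (ord_cons hi gi) (ord_cons x w).
Proof.
move=> hD' hK hx x0.
have hiD k : D (hi k) by exact: D_inverse (hD' k) (hK k).1.
have hn n : op_weak_null (fun k => hi k \o g n k).
  apply: op_weak_null_of_limit (remainder_lim n) _ x0.
    by move=> k; apply: (og_comp (ds_group hD)) => //; exact: pr_D hP _ _.
  by apply: eq_weak_cvg hx => k /=; rewrite (pr_K hP n k).2.
apply: profiles_cons => //.
have hs : weak_cvg (fun k => hi k (superposition g w k)) 0.
  have := weak_cvg_sum (fun n => hn n (w n)).
  rewrite big1 // => H; apply: eq_weak_cvg H => k.
  by rewrite (lin_sum _ _ _ (D_lin (hiD k))).
rewrite -[x]addr0; apply: eq_weak_cvg (weak_cvgD hx hs) => k.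
by rewrite -(linD _ _ (D_lin (hiD k))) subrK.
Qed.

Hypothesis u_bounded : bounded_fun u.

(** The total energy of the profiles is at most that of the sequence. *)
Lemma profiles_F_le (a : nat -> R) (b : R) :
  (forall k, F (u k) <= a k) -> a k @[k --> \oo] --> b ->
  \sum_(n < M) F (w n) <= b.
Proof.
move=> Fa ab.
have [+ _] :=
  ds_split hD (pr_D hP) (pr_K hP) (pr_orth hP) u_bounded (pr_lim hP).
have ab' : (a k)%:E @[k --> \oo] --> b%:E by apply/cvg_EFin => //; near=> k.
rewrite -lee_fin -(cvg_limn_einf_sup ab').1 => /le_trans; apply.
rewrite !limn_einf_lim; apply: lee_lim; [exact: is_cvg_einfs..|].
near=> k; apply: le_ereal_inf_tmp => _ [m /= km <-].
apply: (@le_trans _ _ (F (u m))%:E); last by rewrite lee_fin.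
by apply: ereal_inf_lbound; exists m.
Unshelve. all: by end_near. Qed.

Lemma superposition_F :
  F (superposition g w k) @[k --> \oo] --> (\sum_(n < M) F (w n) : R).
Proof.
by have [_] :=
  ds_split hD (pr_D hP) (pr_K hP) (pr_orth hP) u_bounded (pr_lim hP).
Qed.

End Profiles.

End Dislocation.

Arguments pr_lim {R X D u M g gi w} _ n.
Arguments pr_orth {R X D u M g gi w} _ m n _ x.

(** * The constraint functional along the imbedding *)

Section Imbedding.
Context {R : realType} {X Y : completeNormedModType R}.
Context (F : X -> R^o) (D : set (X -> X)) (G : Y -> R^o) (j : X -> Y).
Hypotheses (hX : exists u : X, u != 0) (hA : assumption_A F D G j).

Let hD : dislocation_space F D := A_dislocation hA.
Let hF : norm_generating F := ds_F hD.
Let hG : norm_generating G := A_G hA.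
Let hj : linear j := ci_linear (A_imbedding hA).
Let sX : separable_space X := ds_separable hD.
Let rX : reflexive_space X := ds_reflexive hD.

Lemma G_D g x : D g -> G (j (g x)) = G (j x).
Proof.
by move=> /(A_extension hA)[gY [_ gYj GgY]]; rewrite -gYj -[in RHS]GgY.
Qed.

Lemma Gj0 : G (j 0) = 0.
Proof. by rewrite (lin0 hj) (ng0 hG). Qed.

Lemma Gj_gt0 x : x != 0 -> 0 < G (j x).
Proof.
move=> x0; apply: (ng_gt0 hG); apply: contra_neq x0 => jx.
by apply: (ci_inj (A_imbedding hA)); rewrite jx (lin0 hj).
Qed.

Lemma GjN x : G (j (- x)) = G (j x).
Proof. by rewrite (linN _ hj) (ng_even hG). Qed.

Lemma G_lsc (u : nat -> X) (l : X) (a : nat -> R) (b : R) :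
  weak_cvg u l -> (\forall k \near \oo, G (j (u k)) <= a k) ->
  a k @[k --> \oo] --> b -> G (j l) <= b.
Proof. exact: (ng_weak_lsc hG hj (ci_continuous (A_imbedding hA))). Qed.

Lemma F_lsc (u : nat -> X) (l : X) (a : nat -> R) (b : R) :
  weak_cvg u l -> (\forall k \near \oo, F (u k) <= a k) ->
  a k @[k --> \oo] --> b -> F l <= b.
Proof.
by apply: (@ng_weak_lsc R X X F id u l a b hF) => // x; exact: cvg_id.
Qed.

Lemma G_split (u : nat -> X) (l : X) : weak_cvg u l ->
  G (j (u k)) - G (j (u k - l)) @[k --> \oo] --> (G (j l) : R).
Proof.
move=> /(A_split hA) h.
suff -> : (fun k => G (j (u k)) - G (j (u k - l)))
    = (fun k => G (j l) + (G (j (u k)) - G (j l) - G (j (l - u k)))).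
  rewrite -[X in _ --> X]addr0; apply: cvgD; [exact: cvg_cst|exact: h].
by apply/funext => k; rewrite -(opprB l) GjN; ring.
Qed.

(** [G] splits exactly over the profiles and the remainder; the profiles are
    split off one at a time. *)
Lemma profiles_G (u : nat -> X) (M : nat) (g gi : 'I_M -> nat -> X -> X)
    (w : 'I_M -> X) : profiles D u g gi w ->
  G (j (u k)) - G (j (u k - superposition g w k)) @[k --> \oo] -->
    (\sum_(n < M) G (j (w n)) : R).
Proof.
elim: M u g gi w => [|M IH] u g gi w hP.
  rewrite big_ord0.
  suff -> : (fun k => G (j (u k)) - G (j (u k - superposition g w k))) = cst 0.
    exact: cvg_cst.
  by apply/funext => k; rewrite /superposition big_ord0 subr0 subrr.
have giD := pr_Di hD hP.
pose u' k := u k - g ord0 k (w ord0).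
have hP' : profiles D u' (fun n => g (lift ord0 n)) (fun n => gi (lift ord0 n))
    (fun n => w (lift ord0 n)).
  split => [n k|n k|m n mn|n].
  - exact: pr_D hP _ _.
  - exact: pr_K hP _ _.
  - by apply: (pr_orth hP); rewrite (inj_eq lift_inj).
  - rewrite -[w _]subr0.
    have h0 := pr_orth hP (lift ord0 n) ord0 (erefl _) (w ord0).
    apply: eq_weak_cvg (weak_cvgB (pr_lim hP (lift ord0 n)) h0) => k /=.
    by rewrite (linB _ _ (D_lin hD (giD _ _))).
have h1 := G_split (pr_lim hP ord0).
have h2 := IH _ _ _ _ hP'.
rewrite big_ord_recl.
apply: cvg_trans (cvgD h1 h2); apply: near_eq_cvg; near=> k.
rewrite /superposition big_ord_recl opprD [u k + (_ + _)]addrA -/(u' k) !fctE.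
rewrite (G_D _ (giD ord0 k)).
have -> : gi ord0 k (u k) - w ord0 = gi ord0 k (u' k).
  by rewrite (linB _ _ (D_lin hD (giD _ _))) (pr_K hP ord0 k).1.
by rewrite (G_D _ (giD ord0 k)) subrKA.
Unshelve. all: by end_near. Qed.

(** [profiles_G] applied to the superposition itself, whose remainder is zero. *)
Lemma superposition_G (u : nat -> X) (M : nat) (g gi : 'I_M -> nat -> X -> X)
    (w : 'I_M -> X) : profiles D u g gi w ->
  G (j (superposition g w k)) @[k --> \oo] --> (\sum_(n < M) G (j (w n)) : R).
Proof.
move=> /(profiles_superposition hD)/profiles_G.
apply: cvg_trans; apply: near_eq_cvg; near=> k.
by rewrite subrr Gj0 subr0.
Unshelve. all: by end_near. Qed.

(** Uniform continuity on a ball bounds [F] there: [N] steps of length less than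
    [d] lead from [0] to any point, and each one changes [F] by at most [1]. *)
Lemma F_bounded (B : R) : exists C : R, forall x : X, `|x| <= B -> F x <= C.
Proof.
have hB : bounded_set [set x : X | `|x| <= B].
  exists B; split; first by rewrite num_real.
  by move=> M BM x /= xB; exact: le_trans xB (ltW BM).
have [d d0 hd] := ds_ucont hD hB ltr01.
have [N hN] : exists N : nat, `|B| / d < N.+1%:R.
  by exists (Num.truncn (`|B| / d)); exact: truncnS_gt.
exists N.+1%:R => x xB.
have N0 : 0 < N.+1%:R :> R by rewrite ltr0n.
suff H : forall i : nat, (i <= N.+1)%N -> F ((i%:R / N.+1%:R) *: x) <= i%:R.
  by have := H N.+1 (leqnn _); rewrite divff ?scale1r // gt_eqF.
have nB (i : nat) : (i <= N.+1)%N -> `|(i%:R / N.+1%:R) *: x| <= B.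
  move=> iN; apply: le_trans xB; rewrite normrZ ler_piMl //.
  by rewrite ger0_norm ?divr_ge0 // ler_pdivrMr // mul1r ler_nat.
elim=> [_|i IH iN]; first by rewrite mul0r scale0r (ng0 hF).
have := hd _ _ (nB i.+1 iN) (nB i (ltnW iN)).
rewrite -scalerBl -mulrBl -natrB // subSnn mul1r normrZ gtr0_norm ?invr_gt0 //.
have h : N.+1%:R^-1 * `|x| < d.
  rewrite mulrC ltr_pdivrMr // mulrC; rewrite ltr_pdivrMr // in hN.
  apply: le_lt_trans hN; apply: (le_trans xB).
  by rewrite real_ler_norm ?num_real.
move=> /(_ h) /ltW; rewrite ler_norml => /andP[_].
rewrite lerBlDr => /le_trans; apply.
by rewrite [in leRHS]mulrS lerD2l; exact: IH (ltnW iN).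
Qed.

(** * The constrained infimum *)

Lemma c_le s x : G (j x) = s -> c_ F G j s <= F x.
Proof.
move=> xs; apply: ge_inf; last by exists x.
by exists 0 => _ [z _ <-]; exact: ng_ge0 hF z.
Qed.

(** A multiple of [x] meets the constraint exactly. *)
Lemma G_scale s (r : R) x : 0 <= s -> 0 <= r -> s <= G (j (r *: x)) ->
  exists2 p : R, 0 <= p <= r & G (j (p *: x)) = s.
Proof.
move=> s0 r0 sr.
have [||p pr Gp] := @IVT _ (fun p : R => G (j (p *: x))) 0 r s r0.
- apply: continuous_subspaceT => p.
  apply: (@continuous_comp _ _ _ (fun p : R => p *: x) (G \o j)).
    by apply: cvgZ; [exact: cvg_id|exact: cvg_cst].
  exact: (A_GX hA).
- rewrite scale0r Gj0; have g0 := le_trans s0 sr.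
  by rewrite (min_idPl g0) (max_idPr g0) s0.
by exists p => //; move: pr; rewrite in_itv.
Qed.

Lemma c_nonempty s : 0 < s -> exists x, G (j x) = s.
Proof.
move=> s0; have [u /Gj_gt0 u0] := hX.
pose r := 1 + s / G (j u).
have su : 0 < s / G (j u) by rewrite divr_gt0.
have r1 : 1 <= r by rewrite lerDl ltW.
have [||p _ <-] := @G_scale s r u (ltW s0).
- exact: le_trans ler01 r1.
- rewrite (linZ _ _ hj); apply: le_trans (ng_scale_ge hG _ r1).
  by rewrite /r mulrDl divfK ?gt_eqF // lerDr mul1r ltW.
by exists (p *: u).
Qed.

Lemma c_approx s e : 0 < s -> 0 < e ->
  exists2 x, G (j x) = s & F x < c_ F G j s + e.
Proof.
move=> s0 e0; have [x0 hx0] := c_nonempty s0.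
have [|_ [x xs <-] Fx] :=
    @inf_adherent _ [set F u | u in [set u : X | G (j u) = s]] _ e0.
  split; first by exists (F x0), x0.
  by exists 0 => _ [z _ <-]; exact: ng_ge0 hF z.
by exists x.
Qed.

(** Sequences that satisfy the constraint in the limit are competitors: they are
    rescaled to satisfy it exactly, and uniform continuity controls the change
    of [F]. *)
Lemma c_le_lim s (y : nat -> X) (a : nat -> R) (b : R) : 0 < s ->
  (\forall k \near \oo, F (y k) <= a k) -> a k @[k --> \oo] --> b ->
  G (j (y k)) @[k --> \oo] --> (s : R) -> c_ F G j s <= b.
Proof.
move=> s0 Fa ab Gs.
apply/ler_addgt0Pr => e e0.
pose B := Num.max 1 (b + 1).
have B1 : 1 <= B by rewrite le_max lexx.
have B0 : 0 < B by exact: lt_le_trans B1.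
have hB : bounded_set [set x : X | `|x| <= 2 * B].
  exists (2 * B); split; first by rewrite num_real.
  by move=> M BM x /= xB; exact: le_trans xB (ltW BM).
have [d d0 hd] := ds_ucont hD hB e0.
have hq : s / G (j (y k)) @[k --> \oo] --> (1 : R).
  rewrite -(divff (lt0r_neq0 s0)); apply: cvgM; first exact: cvg_cst.
  by apply: cvgV => //; rewrite gt_eqF.
have ab' : a k + e @[k --> \oo] --> b + e by apply: cvgD => //; exact: cvg_cst.
apply: (ler_cvg_to (cvg_cst (c_ F G j s)) ab'); near=> k.
have Fk : F (y k) <= a k by near: k.
have ak : a k <= b + 1 by near: k; apply: (cvgr_le _ ab); rewrite ltrDl.
have Gk : 0 < G (j (y k)) by near: k; apply: (cvgr_gt _ Gs).
have q2 : s / G (j (y k)) <= 2 by near: k; apply: (cvgr_le _ hq); rewrite ltr1n.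
have qd : s / G (j (y k)) < 1 + d / B.
  by near: k; apply: (cvgr_lt _ hq); rewrite ltrDl divr_gt0.
set q := s / G (j (y k)) in q2 qd.
pose r := Num.max 1 q.
have r1 : 1 <= r by rewrite le_max lexx.
have r2 : r <= 2 by rewrite ge_max q2 andbT; lra.
have rd : (r - 1) * B < d.
  rewrite -ltr_pdivlMr // ltrBlDl gt_max qd andbT.
  by rewrite ltrDl divr_gt0.
have yB : `|y k| <= B.
  apply: (le_trans (ng_norm_le_max hF _)).
  by rewrite ge_max !le_max lexx /= (le_trans Fk ak) orbT.
(* By convexity [G] grows at least linearly along rays, hence the factor [r]. *)
have sr : s <= G (j (r *: y k)).
  rewrite (linZ _ _ hj); apply: le_trans (ng_scale_ge hG _ r1).
  by rewrite -ler_pdivrMr // le_max lexx orbT.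
have r0 : 0 <= r by exact: le_trans r1.
have [p /andP[p0 pr] /c_le/le_trans] := G_scale (ltW s0) r0 sr; apply.
have /(ng_ray hF (y k))/le_trans : 0 <= p <= r by rewrite p0 pr.
apply.
have yB2 : `|y k| <= 2 * B by apply: (le_trans yB); lra.
have ryB2 : `|r *: y k| <= 2 * B by rewrite normrZ ger0_norm // ler_pM.
have := hd _ _ ryB2 yB2.
rewrite -[X in _ - X]scale1r -scalerBl normrZ ger0_norm ?subr_ge0 //.
have h : (r - 1) * `|y k| < d.
  by apply: le_lt_trans rd; rewrite ler_wpM2l // subr_ge0.
by move=> /(_ h) /ltW; rewrite ler_norml => /andP[_]; lra.
Unshelve. all: by end_near. Qed.

End Imbedding.

(** * Vanishing sequences and exhaustion by profiles *)

(** The bound [B + 1] instead of [B] only spares a limit argument. *)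
Lemma weak_lim_norm {R : realType} {X : normedModType R} (F : X -> R^o)
    (u : nat -> X) (l : X) (B : R) :
  norm_generating F -> (forall k, `|u k| <= B) -> weak_cvg u l -> `|l| <= B + 1.
Proof.
move=> hF uB ul.
have B0 : 0 <= B by exact: le_trans (uB 0%N).
have B1 : 0 < B + 1 by rewrite ltr_wpDl.
apply: (ng_norm_le hF B1).
apply: (@ng_weak_lsc _ _ _ F (fun x : X => (B + 1)^-1 *: x) u l
  (fun=> 1) 1 hF) => //.
- by move=> a x y; rewrite scalerDr !scalerA mulrC.
- by move=> x; apply: cvgZ; [exact: cvg_cst|exact: cvg_id].
- near=> k; apply: (ng_le1 hF).
  rewrite normrZ gtr0_norm ?invr_gt0 // ltr_pdivrMl // mulr1.
  by rewrite (le_lt_trans (uB k)) // ltrDl.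
- exact: cvg_cst.
Unshelve. all: by end_near. Qed.

Section Compactness.
Context {R : realType} {X Y : completeNormedModType R}.
Context (F : X -> R^o) (D : set (X -> X)) (G : Y -> R^o) (j : X -> Y).
Hypotheses (hX : exists u : X, u != 0) (hA : assumption_A F D G j).

Let hD : dislocation_space F D := A_dislocation hA.
Let hF : norm_generating F := ds_F hD.
Let hG : norm_generating G := A_G hA.
Let hj : linear j := ci_linear (A_imbedding hA).
Let sX : separable_space X := ds_separable hD.
Let rX : reflexive_space X := ds_reflexive hD.

Lemma G_null_weak (u : nat -> X) (B : R) : (forall k, `|u k| <= B) ->
  G (j (u k)) @[k --> \oo] --> (0 : R) -> weak_cvg u 0.
Proof.
move=> uB Gu; apply: contrapT => /(not_weak_null hF sX rX uB).
move=> [phi hphi [x x0 hx]].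
have := Gj_gt0 hA x0; apply/negP; rewrite -leNgt.
apply: (G_lsc hA hx _ (cvg_subseq hphi Gu)).
by near=> k.
Unshelve. all: by end_near. Qed.

Lemma G_null_Dweak (u : nat -> X) (B : R) : (forall k, `|u k| <= B) ->
  G (j (u k)) @[k --> \oo] --> (0 : R) -> Dweak_cvg D u 0.
Proof.
move=> uB Gu g gD; apply: (@G_null_weak _ B) => [k|].
  by rewrite subr0 (D_norm hD _ (gD k)).
suff -> : (fun k => G (j (g k (u k - 0)))) = (fun k => G (j (u k))) by [].
by apply/funext => k; rewrite subr0 (G_D hA _ (gD k)).
Qed.

Hypothesis hcoc : cocompact D j.

Lemma Dweak_null_G (u : nat -> X) :
  Dweak_cvg D u 0 -> G (j (u k)) @[k --> \oo] --> (0 : R).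
Proof.
move=> u0; have /cvg_ex[y hy] := hcoc u0.
(* The limit in [Y] is zero: the derivative of [G] at [y] composed with [j] is a
   functional on [X], so it vanishes at [y], and the tangent inequality between
   [y] and [0] gives [G y <= 0]. *)
suff y0 : y = 0.
  rewrite -(ng0 hG) -[in X in _ --> X]y0.
  by apply: (cvg_comp _ _ hy); exact: ng_continuous.
have [dl dc] : dual ('d G y : Y -> R^o) := ng_gradient_dual hG y.
have dj : dual ('d G y \o j : X -> R^o).
  split; first by move=> a x z /=; rewrite hj dl.
  move=> x; apply: continuous_comp; last exact: dc.
  exact: ci_continuous (A_imbedding hA) x.
have h0 : 'd G y (j (u k)) @[k --> \oo] --> ('d G y (j 0) : R^o).
  have := u0 _ (fun=> og_id (ds_group hD)) _ dj.
  by under eq_cvg do rewrite /= subr0.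
have h1 : 'd G y (j (u k)) @[k --> \oo] --> ('d G y y : R^o).
  by apply: (cvg_comp _ _ hy); exact: dc.
have dy : 'd G y y = 0.
  rewrite (cvg_unique (@norm_hausdorff _ R^o) h1 h0).
  by rewrite (lin0 hj) (lin0 dl).
have := ng_gradient hG y 0.
rewrite sub0r (linN _ dl) dy oppr0 addr0 (ng0 hG) => Gy.
apply: contrapT => /eqP /(ng_gt0 hG).
by rewrite ltNge Gy.
Qed.

(** A bounded sequence on which [G] does not tend to zero has a nonzero weak limit
    after translation along a subsequence. *)
Lemma nonvanishing (u : nat -> X) (B : R) : (forall k, `|u k| <= B) ->
  ~ (G (j (u k)) @[k --> \oo] --> (0 : R)) ->
  exists phi, extraction phi /\
  exists g : nat -> X -> X, (forall k, D (g k)) /\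
  exists2 x, x != 0 & weak_cvg (fun k => g k (u (phi k))) x.
Proof.
move=> uB nu.
have /existsNP[g /not_implyP[gD ng]] : ~ Dweak_cvg D u 0.
  by move=> /Dweak_null_G.
have guB k : `|g k (u k - 0)| <= B by rewrite (D_norm hD _ (gD k)) subr0.
have [phi hphi [x x0 hx]] := not_weak_null hF sX rX guB ng.
exists phi; split => //; exists (fun k => g (phi k)); split; first by move=> k.
by exists x => //; apply: eq_weak_cvg hx => k; rewrite subr0.
Qed.

(** If all weak limits of translated subsequences of [r] have [G] at most [d],
    then the whole orbit of [r k] is eventually weakly close, as tested by finitely
    many functionals, to bounded points with [G] at most [d]. *)
Lemma orbit_near_small (r : nat -> X) (B d e : R) (f : nat -> X -> R^o)
    (m : nat) :
  (forall i, dual (f i)) -> 0 < e -> (forall k, `|r k| <= B) ->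
  (forall (g : nat -> X -> X) phi z, (forall k, D (g k)) -> extraction phi ->
     weak_cvg (fun k => g k (r (phi k))) z -> G (j z) <= d) ->
  \forall k \near \oo, forall g, D g -> exists z,
    [/\ `|z| <= B + 1, G (j z) <= d &
     forall i, (i < m)%N -> `|f i (g (r k)) - f i z| <= e].
Proof.
move=> fD e0 rB hd; apply: contrapT => /extract_not_near[phi hphi nphi].
have /choice[g hg] : forall n, exists g, D g /\ ~ exists z,
    [/\ `|z| <= B + 1, G (j z) <= d &
     forall i, (i < m)%N -> `|f i (g (r (phi n))) - f i z| <= e].
  by move=> n; have /existsNP[g /not_implyP[gD ng]] := nphi n; exists g.
have gB k : `|g k (r (phi k))| <= B by rewrite (D_norm hD _ (hg k).1).
have [psi hpsi [z hz]] := weak_compact hF sX rX gB.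
have Gz : G (j z) <= d.
  apply: (hd (g \o psi) (phi \o psi) z _ _ hz); last exact: extraction_comp.
  by move=> k; exact: (hg _).1.
have : \forall k \near \oo, forall i, (i < m)%N ->
    `|f i (g (psi k) (r (phi (psi k)))) - f i z| <= e.
  apply: near_forall_ltn => i.
  by have /cvgrPdistC_le := hz _ (fD i); apply.
move=> /filter_ex[k hk]; apply: (hg (psi k)).2.
exists z; split => //; apply: (weak_lim_norm hF _ hz) => k'.
exact: gB.
Qed.

(** The profiles of a bounded sequence exhaust [lim G]. Otherwise the total [G] of
    finite systems of profiles has a supremum [sigma <= s - e]; the remainders of
    nearly optimal systems have only small profiles, and a diagonal sequence of
    remainders vanishes [D]-weakly although [G] stays away from zero on it. *)
Lemma profiles_exhaust (u : nat -> X) (B s e : R) :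
  (forall k, `|u k| <= B) -> G (j (u k)) @[k --> \oo] --> s -> 0 < e ->
  exists phi, extraction phi /\
  exists M (g gi : 'I_M -> nat -> X -> X) w,
    [/\ profiles D (fun k => u (phi k)) g gi w, forall n, w n != 0 &
     s - e < \sum_(n < M) G (j (w n)) <= s].
Proof.
move=> uB Gu e0.
(* The totals of [G] over finite systems of nonzero profiles. *)
pose isys (a : R) := exists phi, extraction phi /\
  exists M (g gi : 'I_M -> nat -> X -> X) w,
    [/\ profiles D (fun k => u (phi k)) g gi w, forall n, w n != 0 &
     \sum_(n < M) G (j (w n)) = a].
have rem_lim phi M (g gi : 'I_M -> nat -> X -> X) w : extraction phi ->
    profiles D (fun k => u (phi k)) g gi w ->
    G (j (u (phi k) - superposition g w k)) @[k --> \oo] -->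
      s - \sum_(n < M) G (j (w n)).
  move=> hphi /(profiles_G hA) h.
  suff -> : (fun k => G (j (u (phi k) - superposition g w k))) = (fun k =>
      G (j (u (phi k))) -
      (G (j (u (phi k))) - G (j (u (phi k) - superposition g w k)))).
    by apply: cvgB => //; exact: (cvg_subseq hphi Gu).
  by apply/funext => k; rewrite opprB addrCA subrr addr0.
have isys_le a : isys a -> a <= s.
  move=> [phi [hphi [M [g [gi [w [hP _ <-]]]]]]].
  rewrite -subr_ge0; apply: (cvgr_to_ge (rem_lim _ _ _ _ _ hphi hP)).
  by near=> k; exact: ng_ge0 hG _.
have isys0 : isys 0.
  exists id; split; first by [].
  exists 0%N, (fun _ _ => id), (fun _ _ => id), (fun=> 0).
  by split; [split => -[]|case|rewrite big_ord0].
have sup_isys : has_sup isys by split; [exists 0|exists s].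
pose sigma := sup [set a | isys a].
have [es|es] := ltP (s - e) sigma.
  have d0 : 0 < sigma - (s - e) by rewrite subr_gt0.
  have [a ha] := sup_adherent d0 sup_isys.
  rewrite -/sigma opprB addrCA subrr addr0 => ea.
  move: (ha) => [phi [hphi [M [g [gi [w [hP w0 wa]]]]]]].
  exists phi; split => //; exists M, g, gi, w; split => //.
  by rewrite wa ea isys_le.
exfalso.
have [C hC] := F_bounded hA B.
(* Bound for the remainders: the energy of a superposition tends to the energy of
   its profiles, which is at most [C]. *)
pose B' := B + Num.max 1 (C + 1).
have [f [fD fsep]] := separating_family hF sX.
(* [z m] is a term of the remainder of a system within [1 / (m + 1)] of the
   supremum, far enough for its whole orbit to be weakly close to small
   profiles. *)
have /choice[z hz] : forall m : nat, exists z,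
    [/\ `|z| <= B', e / 2 <= G (j z) &
    forall g, D g -> exists y, [/\ `|y| <= B' + 1, G (j y) <= m.+1%:R^-1 &
      forall i, (i < m)%N -> `|f i (g z) - f i y| <= m.+1%:R^-1]].
  move=> m.
  have m0 : 0 < m.+1%:R^-1 :> R by rewrite invr_gt0 ltr0n.
  have [a ha sa] := sup_adherent m0 sup_isys.
  move: (ha) => [phi [hphi [M [g [gi [w [hP w0 wa]]]]]]].
  pose r k := u (phi k) - superposition g w k.
  have ub : bounded_fun (fun k => u (phi k)).
    exact: (bounded_funW (fun k => uB (phi k))).
  have sumC : \sum_(n < M) F (w n) <= C.
    apply: (profiles_F_le hD hP ub (a := fun=> C)); last exact: cvg_cst.
    by move=> k; apply: hC.
  have near_rB : \forall k \near \oo, `|r k| <= B'.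
    near=> k; rewrite (le_trans (ler_normB _ _)) // lerD //.
    apply: (le_trans (ng_norm_le_max hF _)); rewrite ge_max !le_max lexx /=.
    apply/orP; right; near: k.
    apply: (cvgr_le _ (superposition_F hD hP ub)).
    by rewrite (le_lt_trans sumC) // ltrDl.
  have near_Gr : \forall k \near \oo, e / 2 <= G (j (r k)).
    apply: (cvgr_ge _ (rem_lim _ _ _ _ _ hphi hP)).
    rewrite wa; have : a <= sigma by exact: sup_upper_bound ha.
    lra.
  have [N _ rN] := near_rB.
  have Nx : extraction (addn N) by move=> p q; rewrite ltn_add2l.
  have r'B k : `|r (N + k)%N| <= B' by apply: rN => /=; rewrite leq_addr.
  (* A nonzero limit of translated remainders extends the system, so its [G] is
     bounded by the distance to the supremum. *)
  have small (h : nat -> X -> X) psi x :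
      (forall k, D (h k)) -> extraction psi ->
      weak_cvg (fun k => h k (r (N + psi k)%N)) x -> G (j x) <= m.+1%:R^-1.
    move=> hh hpsi hx.
    have [->|x0] := eqVneq x 0; first by rewrite (Gj0 hA) ltW.
    have [hi hiP] := D_seq_inverse hD hh.
    have hiD k : D (hi k) by exact: (D_inverse hD (hh k) (hiP k).1).
    have hchi : extraction (addn N \o psi) by exact: extraction_comp.
    have hP' := profiles_extend hD hX (profiles_subseq hP hchi) hiD
      (fun k => conj (hiP k).2 (hiP k).1) hx x0.
    have : isys (G (j x) + a).
      exists (phi \o (addn N \o psi)); split; first exact: extraction_comp.
      exists M.+1; do 3 eexists; split; first exact: hP'.
        move=> n; case: (unliftP ord0 n) => [n' ->|->];
          by rewrite ?ord_consS ?ord_cons0.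
      rewrite big_ord_recl ord_cons0 -wa; congr (_ + _).
      by apply: eq_bigr => n _; rewrite ord_consS.
    move=> /(sup_upper_bound sup_isys) xa.
    by rewrite -(lerD2r a) (le_trans xa) // -lerBlDl ltW.
  have orb := orbit_near_small m fD m0 r'B small.
  have near_Gr' : \forall k \near \oo, e / 2 <= G (j (r (N + k)%N)).
    exact: (cvg_extraction Nx near_Gr).
  have [k [Gk ok]] := filter_ex (filterI near_Gr' orb).
  by exists (r (N + k)%N).
have : G (j (z m)) @[m --> \oo] --> (0 : R).
  apply: Dweak_null_G => g gD.
  have /choice[y hy] : forall m : nat, exists y, [/\ `|y| <= B' + 1,
      G (j y) <= m.+1%:R^-1 &
      forall i, (i < m)%N -> `|f i (g m (z m)) - f i y| <= m.+1%:R^-1].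
    by move=> m; have [_ _ /(_ _ (gD m))] := hz m.
  have yB m : `|y m| <= B' + 1 by have [] := hy m.
  have y0 : weak_cvg y 0.
    apply: (G_null_weak yB); apply: cvgr_inv_bound; near=> m.
    rewrite sub0r normrN ger0_norm; last exact: ng_ge0 hG _.
    by have [] := hy m.
  have zB m : `|g m (z m - 0)| <= B'.
    by rewrite (D_norm hD _ (gD m)) subr0; have [] := hz m.
  apply: (weak_cvg_family fD fsep rX zB) => i.
  have h1 : f i (g m (z m)) - f i (y m) @[m --> \oo] --> (0 : R).
    apply: cvgr_inv_bound; near=> m; rewrite sub0r normrN.
    have [_ _] := hy m; apply; near: m; exact: nbhs_infty_gt.
  suff -> : (fun m => f i (g m (z m - 0))) =
      (fun m => (f i (g m (z m)) - f i (y m)) + f i (y m)).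
    by rewrite -[X in _ --> X]add0r; apply: cvgD => //; exact: (y0 _ (fD i)).
  by apply/funext => m; rewrite subr0 subrK.
move=> h; have : e / 2 <= 0.
  by apply: (cvgr_to_ge h); near=> m; have [] := hz m.
by rewrite leNgt divr_gt0.
Unshelve. all: by end_near. Qed.

End Compactness.

(** * Compactness of minimizing sequences and strict subadditivity *)

Lemma cvgn_ub {R : realType} (a : nat -> R) (l : R) :
  a k @[k --> \oo] --> l -> exists C, forall k, a k <= C.
Proof.
move=> al; have /cvg_seq_bounded[M [_ /(_ (M + 1))]] : cvgn a.
  by apply/cvg_ex; exists l.
rewrite ltrDl ltr01 => /(_ isT) H.
by exists (M + 1) => k; apply: (le_trans (ler_norm _)); exact: H.
Qed.

Lemma cvg_natSinv {R : realType} : (k.+1%:R^-1 : R) @[k --> \oo] --> (0 : R).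
Proof.
apply: cvgr_inv_bound; near=> n.
by rewrite sub0r normrN ger0_norm // invr_ge0.
Unshelve. all: by end_near. Qed.

Section Equivalence.
Context {R : realType} {X Y : completeNormedModType R}.
Context (F : X -> R^o) (D : set (X -> X)) (G : Y -> R^o) (j : X -> Y) (t : R).
Hypotheses (hX : exists u : X, u != 0) (hA : assumption_A F D G j).
Hypothesis ht : 0 < t.

Let hD : dislocation_space F D := A_dislocation hA.
Let hF : norm_generating F := ds_F hD.
Let hG : norm_generating G := A_G hA.
Let sX : separable_space X := ds_separable hD.
Let rX : reflexive_space X := ds_reflexive hD.

(** A weak limit [x] of [v] joins, untranslated, the nonzero profiles of [v - x].
    Their translations are orthogonal to the identity because [v - x] is weakly
    null. *)
Lemma profiles_id_cons (v : nat -> X) (x : X) (M : nat)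
    (g gi : 'I_M -> nat -> X -> X) (w : 'I_M -> X) :
  weak_cvg v x -> profiles D (fun k => v k - x) g gi w ->
  (forall n, w n != 0) ->
  profiles D v (ord_cons (fun=> id) g) (ord_cons (fun=> id) gi) (ord_cons x w).
Proof.
move=> vx hP w0.
have giD := pr_Di hD hP.
have r0 : weak_cvg (fun k => v k - x) 0.
  by rewrite -(subrr x); apply: weak_cvgB => //; exact: weak_cvg_cst.
have gin n : op_weak_null (gi n).
  exact: (op_weak_null_of_limit hD (giD n) r0 (pr_lim hP n) (w0 n)).
have hP' : profiles D v g gi w.
  split; [exact: pr_D hP|exact: pr_K hP|exact: pr_orth hP|move=> n].
  rewrite -[w n]addr0.
  apply: eq_weak_cvg (weak_cvgD (pr_lim hP n) (gin n x)) => k.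
  by rewrite -(linD _ _ (D_lin hD (giD n k))) subrK.
apply: (profiles_cons hD hX hP') => //.
- by move=> k; exact: og_id (ds_group hD).
- move=> n; apply: (op_weak_null_inverse hD hX (giD n) _ (gin n)) => k.
  exact: (pr_K hP n k).2.
Qed.

Lemma strict_subadditivity_compact (hcoc : cocompact D j) :
  (forall tau : R, 0 < tau < t ->
     c_ F G j t < c_ F G j tau + c_ F G j (t - tau)) ->
  forall u : nat -> X, minimizing F G j t u ->
     exists phi : nat -> nat, extraction phi /\
     exists g : nat -> X -> X, (forall k, D (g k)) /\
     exists w : X, point_of_minimum F G j t w /\
       Dweak_cvg D (fun k => g k (u (phi k))) w.
Proof.
move=> strict u [Fu Gu].
have [C FC] := cvgn_ub Fu.
set B := Num.max 1 C.
have uB k : `|u k| <= B by exact: (ng_bounded_seq hF FC k).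
have nu : ~ (G (j (u k)) @[k --> \oo] --> (0 : R)).
  move=> G0; have t0 : t = 0 := cvg_unique (@norm_hausdorff _ R^o) Gu G0.
  by move: ht; rewrite t0 ltxx.
have [phi [hphi [g [gD [w w0 hw]]]]] := nonvanishing hA hcoc uB nu.
exists phi; split => //; exists g; split => //.
set v := fun k => g k (u (phi k)) in hw *.
have vB k : `|v k| <= B by rewrite (D_norm hD _ (gD k)).
have Fv : F (v k) @[k --> \oo] --> c_ F G j t.
  suff -> : (fun k => F (v k)) = (fun k => F (u (phi k))).
    exact: (cvg_subseq hphi Fu).
  by apply/funext => k; rewrite (D_F hD _ (gD k)).
have Gv : G (j (v k)) @[k --> \oo] --> t.
  suff -> : (fun k => G (j (v k))) = (fun k => G (j (u (phi k)))).
    exact: (cvg_subseq hphi Gu).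
  by apply/funext => k; rewrite (G_D hA _ (gD k)).
set tau := G (j w).
have tau0 : 0 < tau := Gj_gt0 hA w0.
have Gr : G (j (v k - w)) @[k --> \oo] --> t - tau.
  suff -> : (fun k => G (j (v k - w))) =
      (fun k => G (j (v k)) - (G (j (v k)) - G (j (v k - w)))).
    by apply: cvgB => //; exact: (G_split hA hw).
  by apply/funext => k; rewrite opprB addrCA subrr addr0.
have rB k : `|v k - w| <= B + `|w|.
  by rewrite (le_trans (ler_normB _ _)) // lerD2r.
have tau_le : tau <= t.
  rewrite -subr_ge0; apply: (cvgr_to_ge Gr).
  by near=> k; exact: ng_ge0 hG _.
have Fw : F w <= c_ F G j t.
  by apply: (F_lsc hA hw _ Fv); near=> k.
have [tau_t|tau_ne] := eqVneq tau t.
  exists w; split.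
    by split => //; apply/eqP; rewrite eq_le Fw (c_le hA tau_t).
  move: Gr; rewrite tau_t subrr => /(G_null_Dweak hA rB) r0 h hh.
  by apply: eq_weak_cvg (r0 h hh) => k; rewrite subr0.
exfalso.
(* Splitting off [w] leaves the profiles of [v - w], which carry [t - tau]; their
   superpositions compete for [c_(t - tau)]. *)
have tau_lt : tau < t by rewrite lt_neqAle tau_ne.
have := strict tau; rewrite tau0 tau_lt => /(_ isT); apply/negP; rewrite -leNgt.
suff : c_ F G j (t - tau) <= c_ F G j t - F w.
  by have := c_le hA (erefl tau); lra.
have /choice[y hy] : forall m : nat, exists y,
    F y <= c_ F G j t - F w + m.+1%:R^-1 /\ `|t - tau - G (j y)| <= m.+1%:R^-1.
  move=> m.
  have m0 : 0 < m.+1%:R^-1 :> R by rewrite invr_gt0 ltr0n.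
  have [psi [hpsi [M [h [hi [W [hP W0 /andP[W1 W2]]]]]]]] :=
    profiles_exhaust hX hA hcoc rB Gr m0.
  have hP' := profiles_id_cons (weak_cvg_subseq hpsi hw) hP W0.
  have vb : bounded_fun (fun k => v (psi k)).
    exact: (bounded_funW (fun k => vB (psi k))).
  have rb : bounded_fun (fun k => v (psi k) - w).
    exact: (bounded_funW (fun k => rB (psi k))).
  have FW : F w + \sum_(n < M) F (W n) <= c_ F G j t.
    have := profiles_F_le hD hP' vb (fun k => lexx _) (cvg_subseq hpsi Fv).
    rewrite big_ord_recl ord_cons0.
    by under eq_bigr do rewrite ord_consS.
  have nF : \forall k \near \oo,
      F (superposition h W k) <= c_ F G j t - F w + m.+1%:R^-1.
    apply: (cvgr_le _ (superposition_F hD hP rb)).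
    by rewrite ltr_pwDr // lerBrDl.
  have nG1 : \forall k \near \oo,
      G (j (superposition h W k)) <= t - tau + m.+1%:R^-1.
    by apply: (cvgr_le _ (superposition_G hA hP)); rewrite ltr_pwDr.
  have nG2 : \forall k \near \oo,
      t - tau - m.+1%:R^-1 <= G (j (superposition h W k)).
    exact: (cvgr_ge _ (superposition_G hA hP)).
  have [k [Fk [G1 G2]]] := filter_ex (filterI nF (filterI nG1 nG2)).
  exists (superposition h W k); split => //.
  by rewrite ler_distlC G1 G2.
apply: (@c_le_lim _ _ _ _ _ _ _ hA (t - tau) y
  (fun m => c_ F G j t - F w + m.+1%:R^-1)).
- by rewrite subr_gt0.
- by near=> m; exact: (hy m).1.
- rewrite -[X in _ --> X]addr0.
  by apply: cvgD; [exact: cvg_cst|exact: cvg_natSinv].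
- by apply: cvgr_inv_bound; near=> m; exact: (hy m).2.
Unshelve. all: by end_near. Qed.

Section Translates.
Context (h : nat -> X -> X).
Hypotheses (hDh : forall k, D (h k)) (h0 : op_weak_null h).

(** Energies and constraints of [u] and of a receding translate of [v] add up. *)
Lemma translate_sum (u v : X) :
  F (u + h k v) @[k --> \oo] --> (F u + F v : R) /\
  G (j (u + h k v)) @[k --> \oo] --> (G (j u) + G (j v) : R).
Proof.
have [hi hiP] := D_seq_inverse hD hDh.
pose x k := u + h k v.
have xu : weak_cvg x u.
  by rewrite -[u]addr0; apply: weak_cvgD => //; exact: weak_cvg_cst.
have e0 : profiles D (fun k => x k - u) (fun _ : 'I_0 => fun=> id)
  (fun _ : 'I_0 => fun=> id) (fun=> 0) by split => -[].
have [v0|v0] := eqVneq v 0.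
  rewrite v0 (ng0 hF) (Gj0 hA) !addr0.
  suff E k : u + h k 0 = u by split; under eq_cvg do rewrite E; exact: cvg_cst.
  by rewrite (lin0 (D_lin hD (hDh k))) addr0.
have xb : bounded_fun x.
  apply: (@bounded_funW _ _ _ _ (`|u| + `|v|)) => k.
  by rewrite (le_trans (ler_normD _ _)) // (D_norm hD _ (hDh k)).
pose no : 'I_0 -> nat -> X -> X := fun=> fun=> id.
have hP : profiles D x (ord_cons (fun=> id) (ord_cons h no))
    (ord_cons (fun=> id) (ord_cons hi no))
    (ord_cons u (ord_cons v (fun=> 0))).
  apply: (profiles_id_cons xu) => [|n].
    apply: (profiles_cons hD hX e0 hDh hiP) => [[]//|].
    apply: (eq_weak_cvg _ (@weak_cvg_cst _ _ v)) => k.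
    by rewrite /x addrC addKr (hiP k).1.
  by case: (unliftP ord0 n) => [[]//|->]; rewrite ord_cons0.
have E k : superposition (ord_cons (fun=> id) (ord_cons h no))
    (ord_cons u (ord_cons v (fun=> 0))) k = u + h k v.
  by rewrite /superposition !big_ord_recl big_ord0 !ord_consS !ord_cons0 addr0.
have hFs := superposition_F hD hP xb; have hGs := superposition_G hA hP.
rewrite !big_ord_recl !big_ord0 !ord_consS !ord_cons0 !addr0 in hFs hGs.
split.
- by under eq_cvg do rewrite -E.
- by under eq_cvg do rewrite -E.
Qed.

(** For [k] large, no operator of the group keeps both [u] and [h k v] away from
    zero: if [g k u] is not weakly null, then [g k (h k v)] is, along a
    subsequence. *)
Lemma translate_separated (u v : X) (f f' : X -> R^o) (e : R) :
  dual f -> dual f' -> 0 < e ->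
  \forall k \near \oo, forall g, D g ->
    `|f (g u)| <= e \/ `|f' (g (h k v))| <= e.
Proof.
move=> fD fD' e0; apply: contrapT => /extract_not_near[phi hphi nphi].
have /choice[g hg] : forall n, exists g,
    [/\ D g, e < `|f (g u)| & e < `|f' (g (h (phi n) v))|].
  move=> n; have /existsNP[g /not_implyP[gD /not_orP[g1 g2]]] := nphi n.
  by exists g; split => //; rewrite ltNge; apply/negP.
have gD n : D (g n) by case: (hg n).
have ng : ~ op_weak_null g.
  move=> /(_ u f fD); rewrite (lin0 fD.1).
  move=> /cvgr0Pnorm_lt/(_ e e0)/filter_ex[k].
  by have [_ + _] := hg k => /lt_trans /[apply]; rewrite ltxx.
have [psi hpsi] := ds_dichotomy hD gD ng (weak_cvg_subseq hphi (h0 v)).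
move=> /(_ f' fD'); rewrite (lin0 fD'.1).
move=> /cvgr0Pnorm_lt/(_ e e0)/filter_ex[k].
by have [_ _ +] := hg (psi k) => /lt_trans /[apply]; rewrite ltxx.
Qed.

End Translates.

Lemma compact_strict_subadditivity (hB : assumption_B D) :
  (forall u : nat -> X, minimizing F G j t u ->
     exists phi : nat -> nat, extraction phi /\
     exists g : nat -> X -> X, (forall k, D (g k)) /\
     exists w : X, point_of_minimum F G j t w /\
       Dweak_cvg D (fun k => g k (u (phi k))) w) ->
  forall tau : R, 0 < tau < t ->
     c_ F G j t < c_ F G j tau + c_ F G j (t - tau).
Proof.
move=> cpt tau /andP[tau0 tau_t]; rewrite ltNge; apply/negP => c_ge.
have tau'0 : 0 < t - tau by rewrite subr_gt0.
have [h hh h0] := hB.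
have [f [fD fsep]] := separating_family hF sX.
have inv0 (k : nat) : 0 < k.+1%:R^-1 :> R by rewrite invr_gt0 ltr0n.
have /choice[u hu] : forall k : nat, exists x,
    G (j x) = tau /\ F x < c_ F G j tau + k.+1%:R^-1.
  by move=> k; have [x Gx Fx] := c_approx hX hA tau0 (inv0 k); exists x.
have /choice[v hv] : forall k : nat, exists x,
    G (j x) = t - tau /\ F x < c_ F G j (t - tau) + k.+1%:R^-1.
  by move=> k; have [x Gx Fx] := c_approx hX hA tau'0 (inv0 k); exists x.
have /choice[q hq] : forall k : nat, exists q,
    [/\ G (j q) = t - tau, F q = F (v k),
      F (u k + q) <= F (u k) + F (v k) + k.+1%:R^-1,
      `|t - G (j (u k + q))| <= k.+1%:R^-1 &
      forall a, (a < k)%N -> forall b, (b < k)%N -> forall g, D g ->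
        `|f a (g (u k))| <= k.+1%:R^-1 \/ `|f b (g q)| <= k.+1%:R^-1].
  move=> k; have [Fs Gs] := translate_sum hh h0 (u k) (v k).
  have n1 : \forall i \near \oo,
      F (u k + h i (v k)) <= F (u k) + F (v k) + k.+1%:R^-1.
    by apply: (cvgr_le _ Fs); rewrite ltrDl.
  have n2 : \forall i \near \oo, `|t - G (j (u k + h i (v k)))| <= k.+1%:R^-1.
    rewrite (hu k).1 (hv k).1 addrC subrK in Gs.
    by have /cvgrPdist_le := Gs; apply.
  have n3 : \forall i \near \oo, forall a, (a < k)%N -> forall b, (b < k)%N ->
      forall g, D g -> `|f a (g (u k))| <= k.+1%:R^-1 \/
        `|f b (g (h i (v k)))| <= k.+1%:R^-1.
    apply: near_forall_ltn => a; apply: near_forall_ltn => b.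
    exact: (translate_separated h0 (u k) (v k) (fD a) (fD b) (inv0 k)).
  have [i [F1 [G1 s1]]] := filter_ex (filterI n1 (filterI n2 n3)).
  exists (h i (v k)); split => //; last by rewrite (D_F hD _ (hh i)).
  by rewrite (G_D hA _ (hh i)) (hv k).1.
pose z k := u k + q k.
have Gz : G (j (z k)) @[k --> \oo] --> t.
  by apply: cvgr_inv_bound; near=> k; have [] := hq k.
pose a k : R := c_ F G j tau + c_ F G j (t - tau) + 3 * k.+1%:R^-1.
have a_lim : a k @[k --> \oo] --> c_ F G j tau + c_ F G j (t - tau).
  rewrite -[X in _ --> X]addr0; apply: cvgD; first exact: cvg_cst.
  by rewrite -[X in _ --> X](mulr0 3); apply: cvgMr; exact: cvg_natSinv.
have Fza k : F (z k) <= a k.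
  have [_ _ Fq _ _] := hq k; have [_ Fu] := hu k; have [_ Fv] := hv k.
  rewrite (le_trans Fq) //.
  apply: le_trans (lerD (lerD (ltW Fu) (ltW Fv)) (lexx _)) _.
  by rewrite /a; move: (k.+1%:R^-1) => i; lra.
(* [z] competes for [c_t], so equality holds and [z] is minimizing; its energy
   cannot drop below [c_t] along a subsequence. *)
have c_eq : c_ F G j tau + c_ F G j (t - tau) = c_ F G j t.
  apply/eqP; rewrite eq_le c_ge /=.
  by apply: (c_le_lim hA ht _ a_lim Gz); near=> k.
rewrite c_eq in a_lim.
have Fz : F (z k) @[k --> \oo] --> c_ F G j t.
  apply/cvgrPdist_lt => e e0.
  have n1 : \forall k \near \oo, F (z k) < c_ F G j t + e.
    near=> k; apply: (le_lt_trans (Fza k)); near: k.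
    by apply: (cvgr_lt _ a_lim); rewrite ltrDl.
  have n2 : \forall k \near \oo, c_ F G j t - e < F (z k).
    apply: contrapT => /extract_not_near[phi hphi nphi].
    suff : c_ F G j t <= c_ F G j t - e by rewrite leNgt ltrBlDr ltrDl e0.
    apply: (c_le_lim hA ht _ (cvg_cst (c_ F G j t - e)) (cvg_subseq hphi Gz)).
    by near=> k; rewrite leNgt; apply/negP.
  by near=> k; rewrite ltr_distlC; apply/andP; split; near: k.
have [phi [hphi [g [gD [w [[Gw _] zw]]]]]] := cpt z (conj Fz Gz).
have {}zw : weak_cvg (fun k => g k (z (phi k))) w.
  have h1 := zw _ (fun=> og_id (ds_group hD)).
  rewrite -[w]add0r.
  apply: eq_weak_cvg (weak_cvgD h1 (@weak_cvg_cst _ _ w)) => k.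
  by rewrite /= subrK.
(* [w] is the sum of the limits [x] and [w - x] of the two translated parts; both
   are nonzero since neither part carries the whole constraint. *)
pose p k := g k (u (phi k)); pose r k := g k (q (phi k)).
have pB k : `|p k| <= Num.max 1 (c_ F G j tau + 1).
  apply: (ng_bounded_seq hF) => k'.
  rewrite (D_F hD _ (gD k')) (le_trans (ltW (hu (phi k')).2)) // lerD2l.
  by rewrite invf_le1 ?ler1n.
have Gp k : G (j (p k)) = tau by rewrite (G_D hA _ (gD k)) (hu _).1.
have Gr k : G (j (r k)) = t - tau.
  by rewrite (G_D hA _ (gD k)); have [] := hq (phi k).
have [psi hpsi [x px]] := weak_compact hF sX rX pB.
have rx : weak_cvg (fun k => r (psi k)) (w - x).
  apply: eq_weak_cvg (weak_cvgB (weak_cvg_subseq hpsi zw) px) => k.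
  by rewrite (linD _ _ (D_lin hD (gD _))) addrC addKr.
have Gx : G (j x) <= tau.
  by apply: (G_lsc hA px _ (cvg_cst tau)); near=> k; rewrite Gp.
have Gwx : G (j (w - x)) <= t - tau.
  by apply: (G_lsc hA rx _ (cvg_cst (t - tau))); near=> k; rewrite Gr.
have [i fi] : exists i, f i x != 0.
  apply: contrapT => H; have x0 : x = 0.
    by apply: fsep => i; apply: contrapT => fi; apply: H; exists i; apply/eqP.
  by move: Gwx; rewrite x0 subr0 Gw lerBrDr gerDl leNgt tau0.
have [l fl] : exists l, f l (w - x) != 0.
  apply: contrapT => H; have /eqP : w - x = 0.
    by apply: fsep => l; apply: contrapT => fl; apply: H; exists l; apply/eqP.
  rewrite subr_eq0 => /eqP wx.
  by move: Gx; rewrite -wx Gw leNgt tau_t.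
have np : \forall k \near \oo, `|f i x| / 2 < `|f i (p (psi k))|.
  apply: (cvgr_gt _ (cvg_norm (px _ (fD i)))).
  by rewrite ltr_pdivrMr // ltr_pMr ?normr_gt0 // ltr1n.
have nr : \forall k \near \oo, `|f l (w - x)| / 2 < `|f l (r (psi k))|.
  apply: (cvgr_gt _ (cvg_norm (rx _ (fD l)))).
  by rewrite ltr_pdivrMr // ltr_pMr ?normr_gt0 // ltr1n.
have hchi := extraction_comp hphi hpsi.
have ni : \forall k \near \oo, (phi (psi k)).+1%:R^-1 < `|f i x| / 2.
  apply: (cvgr_lt _ (cvg_subseq hchi cvg_natSinv)).
  by rewrite divr_gt0 ?normr_gt0.
have nl : \forall k \near \oo, (phi (psi k)).+1%:R^-1 < `|f l (w - x)| / 2.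
  apply: (cvgr_lt _ (cvg_subseq hchi cvg_natSinv)).
  by rewrite divr_gt0 ?normr_gt0.
have nk : \forall k \near \oo, (maxn i l < phi (psi k))%N.
  exact: (cvg_extraction hchi (nbhs_infty_gt (maxn i l))).
have [k [[[hp hr] [hi hl]]]] :=
  filter_ex (filterI (filterI (filterI np nr) (filterI ni nl)) nk).
rewrite gtn_max => /andP[ik lk].
(* Functionals detecting both limits contradict the separation of the parts. *)
have [_ _ _ _ /(_ i ik l lk _ (gD (psi k)))[]] := hq (phi (psi k));
  rewrite leNgt.
- by rewrite (lt_trans hi hp).
- by rewrite (lt_trans hl hr).
Unshelve. all: by end_near. Qed.

End Equivalence.

Theorem theorem3p5 (R : realType) (X Y : completeNormedModType R)
    (F : X -> R^o) (D : set (X -> X)) (G : Y -> R^o) (j : X -> Y) (t : R)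
    (hX : exists u : X, u != 0)
    (hA : assumption_A F D G j) (hB : assumption_B D)
    (hcoc : cocompact D j) (ht : 0 < t) :
  (forall u : nat -> X, minimizing F G j t u ->
     exists phi : nat -> nat, extraction phi /\
     exists g : nat -> X -> X, (forall k, D (g k)) /\
     exists w : X, point_of_minimum F G j t w /\
       Dweak_cvg D (fun k => g k (u (phi k))) w)
  <->
  (forall tau : R, 0 < tau < t ->
     c_ F G j t < c_ F G j tau + c_ F G j (t - tau)).
Proof.
split; first exact: (compact_strict_subadditivity hX hA ht hB).
exact: (strict_subadditivity_compact hX hA ht hcoc).
Qed.
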